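(* There exists a sequence of finite simple graphs $(G_k)_{k\in\mathbb{N},\,k\ge 2}$ such that, for every $k\ge 2$, \[\chi_f(G_k)<\chi_g(G_k)\le\chi_c(G_k)=k+2,\] and \[\lim_{k\to\infty}\chi_g(G_k)=2.\]
   Context: The fractional chromatic number $\chi_f(G)$ is the smallest real $z$ for which there is an assignment of non-negative weights to the independent sets of $G$ with total weight $z$ such that for each vertex the total weight of independent sets containing it is at least one. The circular chromatic number $\chi_c(G)$ is the smallest real $z$ for which there exists a mapping $f:V(G)\to[0,z)$ such that $1\le|f(v)-f(u)|\le z-1$ for every edge $uv$. Let $\mathbb{T}=\mathbb{R}/\mathbb{Z}$ with Haar (Lebesgue) probability measure $\mu$. A set $A\subseteq \mathbb{T}$ is a coloring $\mathbb{T}$-base for $G$ if there exists a function $f:V(G)\to \mathbb{T}$ such that $A+f(u)$ and $A+f(v)$ are disjoint for every edge $uv$ of $G$. Let $\sigma_{\mathbb{T}}(G)=\sup\{\mu(A): A \text{ is a Borel coloring } \mathbb{T}\text{-base for } G\}$. The gyrochromatic number is $\chi_g(G)=1/\sigma_{\mathbb{T}}(G)$. *)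

(* Defs.v *)
From HB Require Import structures.
From mathcomp Require Import all_boot all_order all_algebra.
From mathcomp Require Import generic_quotient ring_quotient.
From mathcomp Require Import all_classical all_reals all_analysis.
From mathcomp Require Import measurable_realfun ring lra.

Set Implicit Arguments.
Unset Strict Implicit.
Unset Printing Implicit Defensive.

Import Order.TTheory GRing.Theory Num.Theory.
Import numFieldNormedType.Exports.

Local Open Scope classical_set_scope.
Local Open Scope ring_scope.
Local Open Scope quotient_scope.

Record sgraph := SGraph {
  vertex : finType;
  edge : rel vertex;
  edge_sym : symmetric edge;
  edge_irrefl : irreflexive edge }.

Section Circle.
Context (R : realType).

Definition integers : {pred R} := [pred x : R | `[< exists n : int, x = n%:~R >]].

Let integers_closed : zmod_closed integers.
Proof.
split; first by apply/asboolP; exists 0.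
by move=> x y /asboolP[m ->] /asboolP[n ->]; apply/asboolP; exists (m - n); rewrite intrB.
Qed.

HB.instance Definition _ := GRing.isZmodClosed.Build R integers integers_closed.

(* The additive group R/Z with the quotient topology. Despite its name,       *)
(* [{ideal_quot _}] accepts any additive subgroup.                            *)
Definition circle : Type := quotient_topology {ideal_quot (integers : zmodClosed R)}.

HB.instance Definition _ := Topological.on circle.
HB.instance Definition _ := Pointed.on circle.
HB.instance Definition _ := GRing.Zmodule.copy circle {ideal_quot (integers : zmodClosed R)}.

HB.instance Definition _ := Measurable.copy circle
  (g_sigma_algebraType (@open circle)).

Lemma measurable_circleE : @measurable _ circle = <<s @open circle >>.
Proof. by []. Qed.

Definition to_circle (x : R) : circle := \pi_circle x.

Lemma to_circleD : {morph to_circle : x y / x + y}.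
Proof.
exact: (@pi_addr _ _ _ _ _ {ideal_quot (integers : zmodClosed R)}).
Qed.

Lemma to_circle_eq (x y : R) :
  to_circle x = to_circle y <-> exists n : int, x - y = n%:~R.
Proof.
have H := Quotient.idealrBE (integers : zmodClosed R) x y.
split=> [e|[n xyn]].
  have : x - y \in integers by rewrite H; exact/eqP.
  by move/asboolP.
have : x - y \in integers by apply/asboolP; exists n.
by rewrite H => /eqP.
Qed.

Lemma measurable_to_circle : measurable_fun [set: R] to_circle.
Proof.
apply: (@measurability _ _ R circle setT to_circle (@open circle)) => //.
by move=> _ [U oU <-]; rewrite setTI; apply: open_measurable; exact: oU.
Qed.

(* Lebesgue measure transported along the bijection between [0, 1[ and R/Z.   *)
Definition haar : set circle -> \bar R :=
  pushforward (mrestr lebesgue_measure (measurable_itv `[0%R, 1%R[)) to_circle.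

Let haar0 : haar set0 = 0%E.
Proof. by rewrite /haar /pushforward preimage_set0 measure0. Qed.

Let mpre (A : set circle) : measurable A -> measurable (to_circle @^-1` A).
Proof. by move=> mA; rewrite -[X in measurable X]setTI; exact: measurable_to_circle. Qed.

Let haar_ge0 A : (0 <= haar A)%E.
Proof. exact: (measure_ge0 (mrestr _ _)). Qed.

Let haar_sigma_additive : semi_sigma_additive haar.
Proof.
move=> F mF tF mUF; rewrite /haar /pushforward preimage_bigcup.
apply: measure_semi_sigma_additive => [n||].
- exact: mpre.
- apply/trivIsetP => i j _ _ ij; rewrite -preimage_setI.
  by move/trivIsetP : tF => /(_ _ _ _ _ ij) ->//; rewrite preimage_set0.
- by rewrite -preimage_bigcup; exact: mpre.
Qed.

HB.instance Definition _ := isMeasure.Build _ _ _ haar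
  haar0 haar_ge0 haar_sigma_additive.

Let haar_setT : haar setT = 1%E.
Proof.
rewrite /haar /pushforward preimage_setT /mrestr setTI lebesgue_measure_itv/=.
by rewrite lte_fin ltr01 sube0.
Qed.

HB.instance Definition _ := Measure_isProbability.Build _ _ _ haar haar_setT.

Definition translate (A : set circle) (t : circle) : set circle :=
  [set a + t | a in A].

Let lebesgue_shift (B : set R) (c : R) : measurable B ->
  lebesgue_measure ((fun x => x + c) @^-1` B) = lebesgue_measure B.
Proof.
move=> mB.
rewrite -[LHS]/(pushforward lebesgue_measure
  ((fun x => x + c) : R -> measurableTypeR R) B).
apply/esym/lebesgue_measure_unique => //=.
  exact: (@measurable_funD _ R R setT id (cst c)).
move=> _ _ [[a b]] _ <-; rewrite /pushforward /=.
have -> : (fun x => x + c) @^-1` `]a, b]%classic = `]a - c, b - c]%classic.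
  by apply/seteqP; split=> x; rewrite /= !in_itv/= ltrBlDr lerBrDr.
by rewrite !lebesgue_measure_itv/= !lte_fin ltrD2r -!EFinB; case: ifP => // _; congr _%:E; ring.
Qed.

Lemma haar_translate (A : set circle) (t : circle) : measurable A ->
  haar (translate A t) = haar A.
Proof.
move=> mA; pose B := to_circle @^-1` A.
have mB : measurable B := mpre mA.
have Bint x (n : int) : B (x + n%:~R) = B x.
  rewrite /B /preimage/=; congr A; apply/to_circle_eq.
  by exists n; rewrite addrC addKr.
pose r := repr t - (Num.floor (repr t))%:~R.
have r0 : 0 <= r by rewrite subr_ge0 floor_le.
have r1 : r < 1 by rewrite ltrBlDl -intrD1 floorD1_gt.
have tr : t = to_circle r.
  rewrite -[LHS]reprK; apply/to_circle_eq; exists (Num.floor (repr t)).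
  by rewrite opprB addrCA subrr addr0.
have preE : to_circle @^-1` translate A t = (fun x => x - r) @^-1` B.
  apply/seteqP; split=> x /=.
    have -> : to_circle x = to_circle (x - r) + t by rewrite tr -to_circleD subrK.
    by move=> [a Aa /addIr aE]; rewrite /B/= -aE.
  by move=> Bx; exists (to_circle (x - r)) => //; rewrite tr -to_circleD subrK.
rewrite /haar /pushforward /mrestr preE -/B.
have -> : (fun x => x - r) @^-1` B `&` `[0, 1[ =
    (fun x => x - r) @^-1` (B `&` `[- r, 1 - r[).
  rewrite preimage_setI; congr (_ `&` _); apply/seteqP; split=> x /=;
    rewrite !in_itv/=; lra.
rewrite lebesgue_shift; last by apply: measurableI => //; exact: measurable_itv.
have -> : `[- r, 1 - r[%classic = `[- r, 0[ `|` `[0, 1 - r[.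
  by apply: itv_bndbnd_setU; rewrite bnd_simp; lra.
have -> : `[0, 1[%classic = `[0, 1 - r[ `|` `[1 - r, 1[.
  by apply: itv_bndbnd_setU; rewrite bnd_simp; lra.
have disj a b c : B `&` `[a, b[ `&` (B `&` `[b, c[) = set0.
  by apply/seteqP; split=> x //=; rewrite !in_itv/=; lra.
have mBI (i : interval R) : measurable (B `&` [set` i]) by exact: measurableI.
rewrite !setIUr !measureU ?disj//; do ?exact: mBI.
rewrite addeC; congr (_ + _)%E.
have -> : B `&` `[- r, 0[ = (fun x => x + 1) @^-1` (B `&` `[1 - r, 1[).
  rewrite preimage_setI; congr (_ `&` _); apply/seteqP; split=> x /=.
  - by rewrite (Bint x 1).
  - by rewrite (Bint x 1).
  - rewrite !in_itv/=; lra.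
  - rewrite !in_itv/=; lra.
exact: lebesgue_shift.
Qed.

End Circle.

Section Invariants.
Context (R : realType) (G : sgraph).
Implicit Type z : R.

(* The value is arbitrary when [E] has no least element. This does not happen *)
(* for the fractional chromatic number ([fractional_chromatic_numberP]); for  *)
(* the circular one it happens exactly for the edgeless graphs.               *)
Definition minimum (E : set R) : R := get (E `&` lbound E).

Definition independent (I : {set vertex G}) : bool :=
  [forall u in I, forall v in I, ~~ edge u v].

(* Only the values of [w] on independent sets are relevant.                   *)
Definition fractional_coloring z (w : {set vertex G} -> R) : Prop :=
  [/\ forall I, independent I -> 0 <= w I,
      forall v, 1 <= \sum_(I : {set vertex G} | independent I && (v \in I)) w I &
      \sum_(I : {set vertex G} | independent I) w I = z].

Definition fractional_chromatic_number : R :=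
  minimum [set z | exists w, fractional_coloring z w].

Lemma fractional_chromatic_numberP :
  let E := [set z | exists w, fractional_coloring z w] in
  E fractional_chromatic_number /\ lbound E fractional_chromatic_number.
Proof.
move=> E; apply: (@getPex _ (E `&` lbound E)).
pose n : R := #|vertex G|%:R.
pose tot (w : {set vertex G} -> R) := \sum_(I : {set vertex G} | independent I) w I.
pose cov v (w : {set vertex G} -> R) :=
  \sum_(I : {set vertex G} | independent I && (v \in I)) w I.
pose T := prod_topology (fun _ : {set vertex G} => (R : topologicalType)).
pose K : set T := [set w | forall I, `[0, n]%classic (w I)] `&`
  \bigcap_(v in [set: vertex G]) [set w : T | 1 <= cov v w].
have csum (P : pred {set vertex G}) :
    continuous ((fun w => \sum_(I : {set vertex G} | P I) w I) : T -> R).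
  apply: (@continuous_big R _ +%R 0 P (@add_continuous R) T) => I _ w.
  exact: (@proj_continuous _ (fun=> (R : topologicalType)) I w).
have cK : compact K.
  apply: compact_closedI; first exact: (@tychonoff _
    (fun=> (R : topologicalType)) (fun=> `[0, n]%classic)
    (fun=> @segment_compact R 0 n)).
  apply: closed_bigI => v _.
  apply: (@preimage_closed T R (cov v) [set x | 1 <= x]); last exact: closed_ge.
  by move=> w _; exact: csum.
pose w1 : T := fun I => (#|I| == 1%N)%:R.
have ind1 v : independent [set v]%SET.
  apply/forall_inP => a /set1P ->; apply/forall_inP => b /set1P ->.
  by rewrite edge_irrefl.
have w1_ge0 I : 0 <= w1 I by exact: ler0n.
have Kw1 : K w1.
  split=> [I|v _] /=.
    rewrite in_itv/= w1_ge0/= /w1 /n ler_nat.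
    by case: eqP => //= cI; rewrite -cI max_card.
  rewrite /cov (bigD1 [set v]%SET)/=; last by rewrite ind1 set11.
  by rewrite /w1 cards1 lerDl sumr_ge0.
have tot1 : tot w1 <= n.
  rewrite /tot /n -[X in X%:R]bin1 -(card_draws (vertex G) 1) -sum1_card natr_sum.
  rewrite [leRHS]big_mkcond [leLHS]big_mkcond/=; apply: ler_sum => I _.
  by rewrite inE /w1; case: ifP; case: eqP.
have K0 : K !=set0 by exists w1.
have [w wK wmin] := @compact_EVT_min T R tot K K0 cK (continuous_subspaceT (csum _)).
move: wK; rewrite inE => -[w0n wcov].
exists (tot w); split.
  exists w; split => // [I _|v]; last exact: wcov.
  by have /andP[] := w0n I.
move=> z [w' [w'0 w'cov w'z]].
have [zn|nz] := leP z n; last first.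
  apply: le_trans (ltW nz); apply: le_trans tot1; apply: wmin.
  by rewrite inE.
pose w2 : T := fun I => if independent I then w' I else 0.
have -> : z = tot w2.
  by rewrite -w'z; apply: eq_bigr => I iI; rewrite /w2 iI.
apply: wmin; rewrite inE; split.
- move=> I; rewrite /= in_itv/= /w2; case: ifPn => iI.
  + rewrite (w'0 I iI)/= (le_trans _ zn)// -w'z (bigD1 I)//= lerDl.
    by rewrite sumr_ge0// => J /andP[iJ _]; exact: w'0.
  + by rewrite lexx ler0n.
- move=> v _; rewrite /= (le_trans (w'cov v))// le_eqVlt; apply/orP; left.
  by apply/eqP/eq_bigr => I /andP[iI _]; rewrite /w2 iI.
Qed.

Definition circular_coloring z (f : vertex G -> R) : Prop :=
  (forall v, 0 <= f v < z) /\
  (forall u v, edge u v -> 1 <= `|f v - f u| <= z - 1).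

Definition circular_chromatic_number : R :=
  minimum [set z | exists f, circular_coloring z f].

Definition coloring_base (A : set (circle R)) : Prop :=
  exists f : vertex G -> circle R, forall u v, edge u v ->
    translate A (f u) `&` translate A (f v) = set0.

Definition sigma_circle : R :=
  sup [set fine (haar A) | A in [set A | measurable A /\ coloring_base A]].

Definition gyrochromatic_number : R := 1 / sigma_circle.

End Invariants.

(* Main.v *)
(* Let K be the Kneser graph of the ps-subsets of a set of N = (2p+1)s points, H the Kneser graph
   of the p-subsets of 2p+1 points, and q = k+2. The graph G_k is the disjoint union of H and of
   the categorical product of K with the complete graph on q vertices, where s > q^q and p is much
   larger than s. Blowing up each point s times maps H to K, hence G_k to K, so stars give
   chi_f(G_k) <= N/(ps) = 2 + 1/p.
   - chi_g(G_k) is close to 2: adding the indicator vectors of two disjoint ps-sets of points to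
     vectors of F_2^N of weight < ps never gives the same sum, and these vectors have density
     1/2 - O(s / sqrt N). They are transported to R/Z through the expansion in a large base 2h,
     a digit being read as 0 or 1 according to its half, with the digits producing a carry
     excluded.
   - chi_g(G_k) > 2 + 1/p: in a base A, an edge gives d with A and A + d disjoint. For every x, the
     p-sets S with x in A + f(S), and those with x in A + f(S) + d, form two disjoint intersecting
     families. Each contains at most p of the 2p+1 arcs of length p of any circular arrangement of
     the points, and both bounds cannot be attained for all arrangements; average over x.
   - chi_c(G_k) = q: by Lovasz's theorem K is not q^q-colourable. Given a circular colouring f of
     length z < q, colour a vertex X of K by the map sending i to the integral part of f(X, i);
     two adjacent vertices of K receive the same map, which must be a bijection, and walking
     through the q unit intervals gives z >= q. *)
Require Import Defs.
From mathcomp Require Import all_boot all_order all_algebra.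
From mathcomp Require Import fingroup perm generic_quotient zify ring lra.

Set Implicit Arguments.
Unset Strict Implicit.
Unset Printing Implicit Defensive.

(** * Alternating sign sequences and counts modulo 2 *)

(** The points moved by [f] pair off with equal terms, which cancel modulo 2. *)
Lemma big_addb_involution (I : finType) (P F : pred I) (f : I -> I) :
  involutive f -> (forall x, P (f x) = P x) -> (forall x, P x -> F (f x) = F x) ->
  \big[addb/false]_(x | P x) F x = \big[addb/false]_(x | P x && (f x == x)) F x.
Proof.
move=> fK Pf Ff; rewrite (bigID (fun x => f x == x)) /=.
rewrite [X in _ (+) X](_ : _ = false) ?addbF//.
(* The smaller rank selects one point of each pair [x], [f x]. *)
rewrite (bigID (fun x => enum_rank x < enum_rank (f x))) /=.
rewrite [X in _ (+) X](reindex_onto f f) /=; last by move=> i _; rewrite fK.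
set A := bigop _ _ _; rewrite [X in A (+) X](_ : _ = A) ?addbb//.
rewrite /A; apply: eq_big => [i|i /andP[/andP[/andP[+ _] _] _]]; last by rewrite Pf => Pi; exact: Ff.
rewrite fK eqxx andbT Pf eq_sym -andbA -andbA; case: (P i) => //=.
case: eqVneq => //= ne; rewrite -leqNgt leq_eqVlt; case: eqVneq => //= /val_inj/enum_rank_inj.
by move=> e; rewrite -e eqxx in ne.
Qed.

Fixpoint alternating (b : bool) (s : seq bool) :=
  if s is x :: s' then (x == b) && alternating (~~ b) s' else true.

(** If the signs alternate, exactly one deletion, at an end, leaves an alternating sequence
    compatible with [b]. If a single pair of neighbours has equal signs, deleting either of them
    gives the same sequence; in all other cases no deletion alternates. *)
Lemma alternating_rem b (s : seq nat) : sorted leq s -> s != [::] ->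
  \big[addb/false]_(x <- s) alternating b (map odd (rem x s)) =
  alternating true (map odd s) (+) alternating false (map odd s).
Proof.
elim: s b => // a s IH b sas _; rewrite big_cons /= eqxx.
have ss : sorted leq s by move: sas => /= /path_sorted.
(* [rem] deletes the first copy. When [x] equals the head [a], sortedness puts another copy at the
   head of [s], and deleting that one instead gives the same list. *)
rewrite (eq_big_seq (fun x => (odd a == b) && alternating (~~ b) (map odd (rem x s)))); last first.
  move=> x xs /=; case: eqVneq => //= ax; subst x.
  case: s sas ss xs {IH} => // y s /= /andP[ay ps] _ ys; have -> : y = a.
    apply/eqP; rewrite eqn_leq ay andbT; move: ys; rewrite inE => /predU1P[->//|].
    by move=> as_; move: (order_path_min leq_trans ps) => /allP/(_ _ as_).
  by rewrite eqxx.
case: (eqVneq s [::]) => [->|s0].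
  by rewrite big_nil /=; case: (odd a).
have [ab|ab] /= := eqVneq (odd a) b.
  rewrite IH// -ab; case: (odd a) => /=; rewrite ?addbF.
    by rewrite addbA addbb.
  by rewrite addbC addbK.
rewrite big1_eq addbF.
by case: (odd a) b ab => -[]//= _; rewrite addbF.
Qed.

Definition signs (L : seq nat) := map odd (sort leq L).

Lemma perm_signs L1 L2 : perm_eq L1 L2 -> signs L1 = signs L2.
Proof.
by move=> p; congr map; apply/perm_sortP => //; [exact: leq_total|exact: leq_trans|exact: anti_leq].
Qed.

Lemma signs_sorted s : sorted leq s -> signs s = map odd s.
Proof. by move=> ss; rewrite /signs (sorted_sort leq_trans). Qed.

(** Sorting forgets positions: omitting position [k] removes the value [l k] from the sorted list,
    so [alternating_rem] applies. *)
Lemma alternating_delete n (l : 'I_n.+1 -> nat) b :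
  \big[addb/false]_(k < n.+1) alternating b (signs [seq l j | j <- enum 'I_n.+1 & j != k]) =
  alternating true (signs (map l (enum 'I_n.+1))) (+)
  alternating false (signs (map l (enum 'I_n.+1))).
Proof.
set L := map l (enum 'I_n.+1).
have pL : perm_eq (sort leq L) L by exact/permPl/perm_sort.
rewrite -(alternating_rem b) ?(sort_sorted leq_total)//; last first.
  by rewrite -size_eq0 size_sort size_map size_enum_ord.
rewrite (perm_big _ pL) big_map big_enum /=; apply: eq_bigr => k _; congr alternating.
rewrite -signs_sorted; last exact: (subseq_sorted leq_trans (rem_subseq _ _) (sort_sorted leq_total _)).
apply: perm_signs; rewrite -(perm_cons (l k)).
rewrite -[X in perm_eq _ X]/(l k :: rem (l k) (sort leq L)).
have lkL : l k \in sort leq L by rewrite mem_sort map_f ?mem_enum.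
apply: (@perm_trans _ L); last by rewrite (perm_trans _ (perm_to_rem lkL))// perm_sym.
rewrite perm_sym.
rewrite -[X in perm_eq _ X]/(map l (k :: [seq j <- enum 'I_n.+1 | j != k])).
apply: perm_map; rewrite -rem_filter ?enum_uniq// perm_to_rem//.
by rewrite mem_enum.
Qed.

Lemma alternating_negb b s : alternating b (map negb s) = alternating (~~ b) s.
Proof. by elim: s b => //= x s IH b; rewrite IH; case: x b => -[]. Qed.

(** [f] exchanges 2j and 2j + 1. Since [L] contains at most one of these two values, [f] is monotone
    on [L], and it reverses every sign. *)
Lemma signs_half_inj (f : nat -> nat) (L : seq nat) :
    (forall x, f x = ~~ odd x + x./2.*2) ->
    {in L &, forall x y, x./2 = y./2 -> x = y} ->
  signs (map f L) = map negb (signs L).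
Proof.
move=> fE Linj; rewrite /signs -map_comp (_ : sort leq (map f L) = map f (sort leq L)).
  by rewrite -map_comp; apply: eq_map => x /=; rewrite fE oddD odd_double addbF oddb.
apply: (sorted_eq leq_trans anti_leq); first exact: sort_sorted leq_total _.
  apply: (@homo_sorted_in _ _ (mem L) f leq leq); last exact: sort_sorted leq_total _.
    move=> x y xL yL xy; have [/(Linj _ _ xL yL)->//|ne] := eqVneq x./2 y./2.
    by move: xy ne; rewrite !fE; lia.
  by apply/allP => x; rewrite mem_sort.
by rewrite (permPl (permEl (perm_sort _ _))) perm_map// perm_sym perm_sort.
Qed.

(** Neighbours with equal halves would be equal and repeat a sign, so the halves increase
    strictly. *)
Lemma alternating_uniq_half b (s : seq nat) : sorted leq s -> alternating b (map odd s) ->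
  {in s &, forall x y, x./2 = y./2 -> x = y} -> uniq (map half s).
Proof.
move=> ss alt sinj; apply: (sorted_uniq ltn_trans ltnn).
elim: s b ss alt sinj => // x [|y s] IH b //= /andP[xy ps] /andP[/eqP ox alt] sinj.
apply/andP; split; last first.
  apply: IH alt _ => //= u v us vs; apply: sinj; rewrite inE ?us ?vs orbT//.
have ne : x./2 != y./2.
  apply/eqP => /sinj xE; move: alt; rewrite -xE ?inE ?eqxx ?orbT//.
  by rewrite ox; case: (b).
lia.
Qed.

(** * The octahedral Tucker lemma, by Fan's parity count *)

Section Fan.
Variables (T : finType) (lev : {set T * bool} -> nat) (sg : {set T * bool} -> bool).
Implicit Type X : {set T * bool}.

(** Elements of [T * bool] are signed points. The nonempty consistent sets are the faces of the
    cross-polytope on [T], and [negl] induces the antipodal map. *)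
Definition consistent X := [forall t, ~~ (((t, true) \in X) && ((t, false) \in X))].

Definition negl (l : T * bool) := (l.1, ~~ l.2).

Hypothesis lev_opp : forall X, consistent X -> X != set0 -> lev (negl @: X) = lev X.
Hypothesis sg_opp : forall X, consistent X -> X != set0 -> sg (negl @: X) = ~~ sg X.
Hypothesis lev_sg : forall X Y, consistent Y -> X != set0 -> X \subset Y ->
  lev X = lev Y -> sg X = sg Y.

(* The order of the codes is that of the levels, and the parity of a code is its sign. *)
Let label X := sg X + (lev X).*2.

Lemma neglK : involutive negl.
Proof. by case=> t b; rewrite /negl /= negbK. Qed.

Section Words.
Variable n : nat.
Implicit Type w : {ffun 'I_n -> T * bool}.

(* [w] encodes the maximal chain of its prefixes, viewed as signed sets. *)
Definition prefix w (k : nat) := [set w j | j : 'I_n & j <= k].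

Definition labels w := [seq label (prefix w j) | j : 'I_n <- enum 'I_n].

(** For a duplicate-free [e], a signed ordering of its points, hence a maximal chain of faces of the
    cross-polytope on [e]. *)
Definition word (e : seq T) w := perm_eq (codom (fst \o w)) e.

Lemma word_inj e w : uniq e -> word e w -> injective (fst \o w).
Proof. by move=> ue we; apply/injectiveP; rewrite /injectiveb /dinjectiveb (perm_uniq we). Qed.

Lemma prefix_neq0 w (j : 'I_n) : prefix w j != set0.
Proof. by apply/set0Pn; exists (w j); apply: imset_f; rewrite inE. Qed.

Lemma prefix_consistent e w k : uniq e -> word e w -> consistent (prefix w k).
Proof.
move=> ue we; apply/forallP => t; apply/negP => /andP[/imsetP[i _ wi] /imsetP[j _ wj]].
have ji : j = i by apply: (word_inj ue we); rewrite /= -wi -wj.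
by move: wj; rewrite ji -wi.
Qed.

Lemma prefix_sub w i k : i <= k -> prefix w i \subset prefix w k.
Proof.
move=> ik; apply/subsetP => _ /imsetP[j + ->]; rewrite inE => ji.
by apply: imset_f; rewrite inE (leq_trans ji).
Qed.

Lemma labels_half_inj e w : uniq e -> word e w ->
  {in labels w &, forall x y, x./2 = y./2 -> x = y}.
Proof.
move=> ue we _ _ /mapP[i _ ->] /mapP[j _ ->]; rewrite /label !half_bit_double => eij.
rewrite eij; congr (nat_of_bool _ + _).
wlog ij : i j eij / i <= j => [hw|].
  by case/orP: (leq_total i j) => [/hw->|/hw->].
exact: lev_sg (prefix_consistent j ue we) (prefix_neq0 _ _) (prefix_sub _ ij) eij.
Qed.

Definition negw w := [ffun j => negl (w j)].

Lemma negwK : involutive negw.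
Proof. by move=> w; apply/ffunP => j; rewrite !ffunE neglK. Qed.

Lemma word_negw e w : word e (negw w) = word e w.
Proof. by rewrite /word /codom; congr perm_eq; apply: eq_map => j /=; rewrite ffunE. Qed.

Lemma prefix_negw w k : prefix (negw w) k = negl @: prefix w k.
Proof. by rewrite /prefix -imset_comp; apply: eq_imset => j; rewrite ffunE. Qed.

Lemma signs_negw e w : uniq e -> word e w -> signs (labels (negw w)) = map negb (signs (labels w)).
Proof.
move=> ue we; rewrite -(@signs_half_inj (fun x => ~~ odd x + x./2.*2))//.
  rewrite /labels -map_comp; congr signs; apply: eq_map => j /=.
  rewrite prefix_negw /label oddD odd_double addbF oddb half_bit_double.
  by rewrite lev_opp ?sg_opp ?prefix_neq0 ?(prefix_consistent _ ue we).
exact: labels_half_inj ue we.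
Qed.

End Words.

Section Step.
Variables (a : T) (e : seq T) (n : nat).
Hypothesis ue : uniq (a :: e).
Implicit Type w : {ffun 'I_n.+1 -> T * bool}.

Definition hemisphere b w := word (a :: e) w && ((a, b) \in codom w).

Definition face w k := [seq label (prefix w j) | j : 'I_n.+1 <- enum 'I_n.+1 & j != k].

Lemma hemisphereE b w : hemisphere b w = word (a :: e) w && ((a, ~~ b) \notin codom w).
Proof.
rewrite /hemisphere; case: (boolP (word _ w)) => //= we.
have : a \in codom (fst \o w) by rewrite (perm_mem we) mem_head.
move=> /codomP[i /= ai].
apply/idP/idP => [/codomP[j wj]|].
  apply/negP => /codomP[l wl].
  have jl : j = l by apply: (word_inj ue we) => /=; rewrite -wj -wl.
  by move: wl; rewrite -jl -wj => -[]; case: (b).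
move=> nb; apply/codomP; exists i; case: (w i) (codom_f w i) ai => a' b' abi /= aE; subst a'.
by move: nb; case: b b' abi => -[] //= ->.
Qed.

Lemma hemisphere_negw b w : hemisphere b (negw w) = hemisphere (~~ b) w.
Proof.
rewrite /hemisphere word_negw; congr andb; apply/codomP/codomP => -[j].
  by rewrite ffunE => /(congr1 negl); rewrite neglK => wj; exists j.
by move=> wj; exists j; rewrite ffunE -wj /negl /= negbK.
Qed.

(** The antipodal map carries the words with [a] negative to those with [a] positive and exchanges
    the two possible first signs. *)
Lemma sum_hemisphere :
  \big[addb/false]_(w : {ffun 'I_n.+1 -> T * bool} | word (a :: e) w) alternating true (signs (labels w)) =
  \big[addb/false]_(w | hemisphere true w)
     (alternating true (signs (labels w)) (+) alternating false (signs (labels w))).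
Proof.
rewrite big_split /= (bigID (fun w => (a, true) \in codom w)) /=; congr addb.
rewrite (reindex_inj (inv_inj (@negwK _))) /=.
under eq_bigl => w do rewrite -(hemisphereE false (negw w)) hemisphere_negw.
apply: eq_bigr => w /andP[we _]; rewrite (signs_negw ue we) alternating_negb//.
Qed.

Lemma word_comp_perm w (s : {perm 'I_n.+1}) :
  word (a :: e) [ffun j => w (s j)] = word (a :: e) w.
Proof.
have ps : perm_eq (codom (fst \o [ffun j => w (s j)])) (codom (fst \o w)).
  have -> : codom (fst \o [ffun j => w (s j)]) = map ((fst \o w) \o s) (enum 'I_n.+1).
    by apply: eq_map => j; rewrite /= ffunE.
  rewrite map_comp -[codom _]/(map (fst \o w) (enum 'I_n.+1)) perm_map//.
  apply: uniq_perm; rewrite ?(map_inj_uniq (@perm_inj _ s)) ?enum_uniq//.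
  by move=> x; rewrite mem_enum; apply/mapP; exists ((s^-1)%g x); rewrite ?mem_enum ?permKV.
by rewrite /word (permPl ps).
Qed.

(** Exchanging the letters at [k] and k + 1 changes only the prefix that the face omits, and fixes
    no word, so the terms cancel in pairs. *)
Lemma interior_face (k : 'I_n.+1) : k < n ->
  \big[addb/false]_(w | hemisphere true w) alternating true (signs (face w k)) = false.
Proof.
move=> kn; pose k' : 'I_n.+1 := Ordinal (kn : k.+1 < n.+1).
pose sw w := [ffun j => w (tperm k k' j)].
have swK : involutive sw by move=> w; apply/ffunP => j; rewrite !ffunE tpermK.
rewrite (big_addb_involution swK).
- rewrite big_pred0// => w; apply/negP => /andP[/andP[we _] /eqP/ffunP/(_ k)].
  rewrite ffunE tpermL => /(congr1 fst)/(word_inj ue we) /(congr1 val) /=; lia.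
- move=> w; rewrite /hemisphere word_comp_perm; congr andb.
  apply/codomP/codomP => -[j ->]; exists (tperm k k' j); first by rewrite ffunE.
  by rewrite ffunE tpermK.
- move=> w _; congr (alternating _ (signs _)); apply/eq_in_map => j.
  rewrite mem_filter => /andP[jk _]; congr label; rewrite /prefix.
  rewrite (eq_imset _ (_ : _ =1 w \o tperm k k')); last by move=> i; rewrite /= ffunE.
  suff tS : tperm k k' @: [set i : 'I_n.+1 | i <= j] = [set i : 'I_n.+1 | i <= j].
    by rewrite imset_comp tS.
  apply/eqP; rewrite eqEcard card_imset ?leqnn ?andbT; last exact: perm_inj.
  apply/subsetP => _ /imsetP[i + ->]; rewrite !inE.
  move: jk; case: tpermP => [->|->|//]; rewrite -val_eqE /=; lia.
Qed.

(** Reversing the sign of the last letter, unless its point is [a], changes only the omitted prefix.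
    The fixed words of the hemisphere end with [(a, true)]; dropping this letter gives the words
    over [e]. *)
Lemma last_face :
  \big[addb/false]_(w | hemisphere true w) alternating true (signs (face w ord_max)) =
  \big[addb/false]_(w : {ffun 'I_n -> T * bool} | word e w) alternating true (signs (labels w)).
Proof.
pose fl w := [ffun j => if (j == ord_max) && ((w j).1 != a) then negl (w j) else w j].
have flK : involutive fl.
  move=> w; apply/ffunP => j; rewrite !ffunE.
  case: (j == ord_max) => //=.
  by case c : ((w j).1 != a); rewrite /= c ?neglK.
have prefix_fl w j : j < n -> prefix (fl w) j = prefix w j.
  move=> jn; apply: eq_in_imset => i; rewrite inE => ij; rewrite ffunE.
  by case: eqVneq => //= ie; move: ij; rewrite ie /=; lia.
rewrite (big_addb_involution flK); last first.
- move=> w _; congr (alternating _ (signs _)); apply/eq_in_map => j.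
  rewrite mem_filter => /andP[jk _]; rewrite prefix_fl//.
  by move: jk; rewrite -val_eqE /=; case: j => j /=; lia.
- move=> w; rewrite /hemisphere; congr andb.
    rewrite /word /codom; congr perm_eq; apply: eq_map => j /=; rewrite ffunE.
    by case: ifP.
  apply/codomP/codomP => -[j]; rewrite ?ffunE.
    case: ifP => [/andP[_ wa] wj|_ ->]; last by exists j.
    by move: wa; rewrite -[w j]neglK -wj eqxx.
  by move=> wj; exists j; rewrite ffunE -wj eqxx andbF.
pose ext (w : {ffun 'I_n -> T * bool}) : {ffun 'I_n.+1 -> T * bool} :=
  [ffun j => if unlift ord_max j is Some i then w i else (a, true)].
pose res w : {ffun 'I_n -> T * bool} := [ffun j => w (lift ord_max j)].
have codom_ext (u : {ffun 'I_n -> T * bool}) : codom (fst \o ext u) = rcons (codom (fst \o u)) a.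
  rewrite -[codom (fst \o ext u)]/(map (fst \o ext u) (enum 'I_n.+1)).
  rewrite enum_ordSr map_rcons /= ffunE unlift_none; congr rcons.
  rewrite -map_comp; apply: eq_map => j /=; rewrite ffunE.
  by rewrite (_ : widen_ord _ _ = lift ord_max j) ?liftK//; apply/val_inj; rewrite /= /bump leqNgt ltn_ord.
have word_ext (u : {ffun 'I_n -> T * bool}) : word (a :: e) (ext u) = word e u.
  by rewrite /word codom_ext perm_rcons perm_cons.
rewrite (reindex_onto ext res); last first.
  move=> w /andP[/andP[we ta] /eqP/ffunP/(_ ord_max)]; rewrite ffunE eqxx /=.
  case: eqVneq => [wa _|wa]; last first.
    by move=> /(congr1 snd) /=; case: (_.2).
  have wmax : w ord_max = (a, true).
    case/codomP: ta => j wj; rewrite wj; congr (w _).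
    by apply: (word_inj ue we); rewrite /= wa -wj.
  apply/ffunP => j; rewrite ffunE; case: unliftP => [i ->|->]; last by rewrite wmax.
  by rewrite ffunE.
apply: eq_big => [w|w _].
  rewrite (_ : res (ext w) == w); last first.
    by apply/eqP/ffunP => j; rewrite !ffunE liftK.
  rewrite andbT /hemisphere word_ext -andbA; case: (word e w) => //=; apply/andP; split.
    by apply/codomP; exists ord_max; rewrite ffunE unlift_none.
  apply/eqP/ffunP => j; rewrite ffunE; case: eqP => //= ->.
  by rewrite ffunE unlift_none eqxx.
congr (alternating _ (signs _)); rewrite /face enum_ordSr filter_rcons eqxx /=.
rewrite (_ : filter _ _ = map (lift ord_max) (enum 'I_n)); last first.
  rewrite (eq_map (_ : _ =1 lift ord_max)); last first.
    by move=> j; apply/val_inj; rewrite /= /bump leqNgt ltn_ord.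
  by apply/all_filterP/allP => _ /mapP[j _ ->]; rewrite eq_sym neq_lift.
rewrite -map_comp; apply: eq_map => j /=; congr label; apply/setP => l.
have bumpn (i : 'I_n) : bump n i = i by rewrite /bump leqNgt ltn_ord.
apply/imsetP/imsetP => -[i]; rewrite inE /= bumpn => ij ->.
  move: ij; rewrite ffunE; case: unliftP => [i' ->|->] /=; last by rewrite leqNgt ltn_ord.
  by rewrite bumpn => ij; exists i'; rewrite ?inE.
by exists (lift ord_max i); rewrite ?ffunE ?liftK// inE /= !bumpn.
Qed.

(* Count the pairs of a maximal chain of the hemisphere and an alternating facet of it: a chain
   contributes an odd number iff it is alternating, a facet in the interior is in two chains and a
   facet in the boundary sphere is in one. *)
Lemma fan_step :
  \big[addb/false]_(w : {ffun 'I_n.+1 -> T * bool} | word (a :: e) w) alternating true (signs (labels w)) =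
  \big[addb/false]_(w : {ffun 'I_n -> T * bool} | word e w) alternating true (signs (labels w)).
Proof.
rewrite sum_hemisphere.
under eq_bigr => w _ do rewrite -(alternating_delete (fun j => label (prefix w j)) true).
rewrite exchange_big /= big_ord_recr /= -last_face big1 => [//|k _].
by rewrite interior_face//=.
Qed.

End Step.

(** [fan_step] preserves the parity down to the single empty word, whose empty label sequence
    alternates. *)
Lemma fan (e : seq T) : uniq e ->
  \big[addb/false]_(w : {ffun 'I_(size e) -> T * bool} | word e w)
    alternating true (signs (labels w)).
Proof.
elim: e => [_|a e IH ue]; last by rewrite /= fan_step// IH//; case/andP: ue.
rewrite (big_pred1 (ffun0 (card_ord 0))) => [|w].
  by rewrite /labels (size0nil (size_enum_ord 0)).
rewrite /word (size0nil (_ : size (codom (fst \o w)) = 0)) ?size_codom ?card_ord//=.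
by apply/esym/eqP/ffunP => -[].
Qed.

(** An odd number of words have alternating labels, so one exists; its [#|T|] prefixes have distinct
    levels, all below [M]. *)
Lemma octahedral_tucker M :
  (forall X, consistent X -> X != set0 -> lev X < M) -> #|T| <= M.
Proof.
move=> levM; have := fan (enum_uniq T); rewrite -cardE => /esym.
case: (pickP (fun w : {ffun 'I_#|T| -> T * bool} =>
    word (enum T) w && alternating true (signs (labels w)))) => [w /andP[we alt] _|no]; last first.
  by rewrite big1// => w we; move: (no w); rewrite we.
have inj : {in sort leq (labels w) &, forall x y, x./2 = y./2 -> x = y}.
  by move=> x y; rewrite !mem_sort; exact: (labels_half_inj (enum_uniq T) we).
have un := alternating_uniq_half (sort_sorted leq_total _) alt inj.
have := uniq_leq_size un (_ : {subset _ <= iota 0 M}).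
rewrite size_iota size_map size_sort size_map size_enum_ord; apply => _ /mapP[x + ->].
rewrite mem_sort mem_iota => /mapP[j _ ->] /=; rewrite half_bit_double levM ?prefix_neq0//.
exact: prefix_consistent (enum_uniq T) we.
Qed.

End Fan.

Arguments negl {T}.

(** * Lower bound on the chromatic number of Kneser graphs *)

Section KneserChromatic.
Variables (T : finType) (m s C : nat) (c : {set T} -> nat).
Implicit Types (A B : {set T}) (X Y : {set T * bool}).
Hypothesis m_gt0 : 0 < m.
Hypothesis cardT : #|T| = m.*2 + s.
Hypothesis c_lt : forall A : {set T}, #|A| = m -> c A < C.
Hypothesis c_proper : forall A B : {set T}, #|A| = m -> #|B| = m -> [disjoint A & B] -> c A != c B.

Let side (b : bool) (X : {set T * bool}) := [set t | (t, b) \in X].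

Let has_color (A : {set T}) j := [exists B : {set T}, [&& B \subset A, #|B| == m & c B == j]].

(** The least color of an [m]-subset of [A], or [C] if there is none, as a failing [find] returns
    the length of the list. *)
Let mincol (A : {set T}) := find (has_color A) (iota 0 C).

Let mincol_witness A : mincol A < C -> has_color A (mincol A).
Proof.
move=> h; have := h; rewrite -[X in _ < X](size_iota 0 C) -has_find => /(nth_find 0).
by rewrite -/(mincol A) nth_iota.
Qed.

Let mincol_le (A B : {set T}) : B \subset A -> #|B| = m -> mincol A <= c B.
Proof.
move=> BA Bm; rewrite leqNgt; apply/negP => /(before_find 0).
rewrite nth_iota ?c_lt// add0n => /negbT/negP; apply; apply/existsP; exists B.
by rewrite BA Bm !eqxx.
Qed.

Let mincol_leC A : mincol A <= C.
Proof. by rewrite -[X in _ <= X](size_iota 0 C) find_size. Qed.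

Let mincol_lt A : m <= #|A| -> mincol A < C.
Proof.
move=> mA; have [B BA Bm] : exists2 B : {set T}, B \subset A & #|B| = m.
  have := mA; rewrite -bin_gt0 -cards_draws card_gt0 => /set0Pn[B].
  by rewrite inE => /andP[BA /eqP Bm]; exists B.
exact: leq_ltn_trans (mincol_le BA Bm) (c_lt Bm).
Qed.

Let mincol_sub (A A' : {set T}) : A \subset A' -> mincol A' <= mincol A.
Proof.
move=> AA'; have := mincol_leC A; rewrite leq_eqVlt => /predU1P[->//|/mincol_witness].
move=> /existsP[B /and3P[BA /eqP Bm /eqP <-]]; apply: mincol_le => //.
exact: subset_trans AA'.
Qed.

Let mincol_disjoint (A A' : {set T}) : [disjoint A & A'] -> mincol A < C -> mincol A != mincol A'.
Proof.
move=> dA hA; apply/eqP => e; have := hA; rewrite e => /mincol_witness.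
have := mincol_witness hA; move=> /existsP[B /and3P[BA /eqP Bm /eqP cB]].
move=> /existsP[B' /and3P[BA' /eqP Bm' /eqP cB']].
have dB : [disjoint B & B'] by apply: disjointWl BA _; apply: disjointWr BA' _.
by have := c_proper Bm Bm' dB; rewrite cB cB' e eqxx.
Qed.

Let sides_sub X Y b : X \subset Y -> side b X \subset side b Y.
Proof. by move=> XY; apply/subsetP => t; rewrite !inE; apply: (subsetP XY). Qed.

Let sides_disjoint X b : consistent X -> [disjoint side b X & side (~~ b) X].
Proof.
move=> /forallP cX; apply/pred0P => t; rewrite /= !inE; apply/negP.
by have := cX t; case: b => /=; [|rewrite andbC]; move/negP.
Qed.

Let card_sides X : #|side true X| + #|side false X| = #|X|.
Proof.
have inj (b : bool) : injective (fun t : T => (t, b)) by move=> t u [].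
rewrite -(card_imset _ (inj true)) -(card_imset _ (inj false)) -cardsUI.
rewrite (_ : _ :&: _ = set0) ?cards0 ?addn0; last first.
  apply/setP => -[t b]; rewrite !inE; apply/negP => /andP[/imsetP[u _ [_ ->]] /imsetP[v _ []]].
  by [].
apply: eq_card => -[t b]; rewrite !inE; apply/orP/idP => [[]/imsetP[u]|tX].
- by rewrite inE => uX [-> ->].
- by rewrite inE => uX [-> ->].
- case: b tX => tX; [left|right]; apply/imsetP; exists t => //; by rewrite inE.
Qed.

Let big_side X : m.*2 - 2 < #|X| -> minn (mincol (side true X)) (mincol (side false X)) < C.
Proof.
rewrite -card_sides => h; rewrite gtn_min.
have [/mincol_lt->//|?] := leqP m #|side true X|.
by rewrite (mincol_lt (A := side false X)) ?orbT//; lia.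
Qed.

(* A signed set with more than 2m - 2 elements has a side containing an m-set. *)
Let lev X := if #|X| <= m.*2 - 2 then #|X|.-1
  else m.*2 - 2 + minn (mincol (side true X)) (mincol (side false X)).

(** Nested nonempty small sets of equal level coincide, so any rule reversed by negation serves for
    them; [pick] sees only the underlying points, which negation keeps. On large sets the sign tells
    which side has the smaller least color. *)
Let sg (X : {set T * bool}) := if #|X| <= m.*2 - 2 then
    if [pick t | ((t, true) \in X) || ((t, false) \in X)] is Some t then (t, true) \in X else false
  else mincol (side true X) < mincol (side false X).

Let mem_negl X (t : T) (b : bool) : ((t, b) \in negl @: X) = ((t, ~~ b) \in X).
Proof.
rewrite -[in LHS](negbK b) -[(t, ~~ ~~ b)]/(negl (t, ~~ b)) mem_imset//.
exact: inv_inj (@neglK _).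
Qed.

Let side_negl X b : side b (negl @: X) = side (~~ b) X.
Proof. by apply/setP => t; rewrite !inE mem_negl. Qed.

Let card_negl X : #|negl @: X| = #|X|.
Proof. by rewrite card_imset//; exact: inv_inj (@neglK _). Qed.

(** All levels are below 2m - 2 + C, so the octahedral Tucker lemma bounds 2m + s by this number. *)
Lemma kneser_chromatic : s.+2 <= C.
Proof.
suff : #|T| <= m.*2 - 2 + C by rewrite cardT; lia.
apply: (@octahedral_tucker T lev sg).
- by move=> X _ _; rewrite /lev card_negl !side_negl minnC.
- move=> X cX X0; rewrite /sg card_negl !side_negl; case: (leqP #|X|) => cardX.
    rewrite (eq_pick (_ : _ =1 fun t => ((t, true) \in X) || ((t, false) \in X))); last first.
      by move=> t /=; rewrite !mem_negl orbC.
    case: pickP => [t /=|no]; last first.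
      case/set0Pn: X0 => -[t b] tX; move: (no t) => /=.
      by case: b tX => -> //; rewrite orbT.
    by rewrite mem_negl /=; move/forallP: cX => /(_ t); do 2 case: (_ \in X).
  have := mincol_disjoint (sides_disjoint true cX).
  have := mincol_disjoint (sides_disjoint false cX).
  have := big_side cardX; rewrite /=; lia.
- move=> X Y cY X0 XY; rewrite /lev /sg.
  have cXY := subset_leq_card XY.
  have X1 : 0 < #|X| by rewrite card_gt0.
  case: (leqP #|X|) => cX; case: (leqP #|Y|) => cYm; try lia.
    move=> e; have -> // : X = Y by apply/eqP; rewrite eqEcard XY; lia.
  move/addnI.
  (* Least colors can only decrease under inclusion. Opposite signs at equal levels would give a
     side of [X] and the opposite side of [Y], which are disjoint, the same least color below
     [C]. *)
  have := mincol_sub (sides_sub true XY); have := mincol_sub (sides_sub false XY).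
  have := big_side cX; have := big_side cYm.
  have := mincol_disjoint (sides_disjoint true cY).
  have d1 : [disjoint side true X & side false Y].
    exact: disjointWl (sides_sub true XY) (sides_disjoint true cY).
  have d2 : [disjoint side false X & side true Y].
    exact: disjointWl (sides_sub false XY) (sides_disjoint false cY).
  have := mincol_disjoint d1; have := mincol_disjoint d2 => /=.
  lia.
- move=> X _ X0; rewrite /lev; case: (leqP #|X|) => cX; last by rewrite ltn_add2l big_side.
  have : 0 < #|X| by rewrite card_gt0.
  by lia.
Qed.

End KneserChromatic.

(** * Arcs in cyclic arrangements of 2p + 1 points *)

Section Arcs.
Variables (T : finType) (p : nat).
Local Notation n := p.*2.+1.
Implicit Types (w : 'I_n -> T) (j : 'I_n).

(** The positions j, ..., j + p - 1 modulo 2p + 1; the second branch is the part that wraps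
    around. *)
Definition arc_positions j : {set 'I_n} :=
  [set i : 'I_n | if j <= i then i < j + p else i + n < j + p].

Definition arc w j : {set T} := w @: arc_positions j.

Lemma mem_arc_positions j i : j + p <= n -> (i \in arc_positions j) = (j <= i < j + p).
Proof. by rewrite inE; case: ifP; lia. Qed.

Lemma card_arc_positions j : #|arc_positions j| = p.
Proof.
have r_lt (i : 'I_p) : (if j + i < n then j + i else j + i - n) < n.
  have := ltn_ord i; have := ltn_ord j; case: ifP; lia.
pose r i : 'I_n := Ordinal (r_lt i).
have rinj : injective r.
  move=> a b /(congr1 val) /=; have := ltn_ord a; have := ltn_ord b; have := ltn_ord j.
  by move=> ? ? ?; do 2 case: ifP; move=> ? ? ?; apply/val_inj => /=; lia.
rewrite -[RHS]card_ord -(card_imset _ rinj); apply: eq_card => i; rewrite inE.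
apply/idP/imsetP => [|[a _ ->]] /=; last first.
  by have := ltn_ord a; have := ltn_ord j; do ?case: ifP => /=; lia.
have := ltn_ord i; have := ltn_ord j => ? ?.
case: ifP => ji ip.
  have h : i - j < p by lia.
  by exists (Ordinal h) => //; apply/val_inj => /=; case: ifP; lia.
have h : i + n - j < p by lia.
by exists (Ordinal h) => //; apply/val_inj => /=; case: ifP; lia.
Qed.

Lemma card_arc w j : injective w -> #|arc w j| = p.
Proof. by move=> winj; rewrite card_imset ?card_arc_positions. Qed.

(** The arc starting [p] positions further is disjoint, so the counted positions and their shifts by
    [p] are disjoint sets among 2p + 1 positions. *)
Lemma arcs_intersecting (F : pred {set T}) w : injective w ->
    (forall A B, F A -> F B -> ~~ [disjoint A & B]) ->
  #|[set j | F (arc w j)]| <= p.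
Proof.
move=> winj Fint; set K := [set j | _].
have sh_lt (j : 'I_n) : (if j + p < n then j + p else j + p - n) < n.
  have := ltn_ord j; case: ifP; lia.
pose sh j : 'I_n := Ordinal (sh_lt j).
have shinj : injective sh.
  move=> a b /(congr1 val) /=; have := ltn_ord a; have := ltn_ord b.
  by move=> ? ?; do 2 case: ifP; move=> ? ? ?; apply/val_inj => /=; lia.
have dK : [disjoint K & sh @: K].
  apply/pred0P => j /=; apply/negP => /andP[]; rewrite inE => Fj /imsetP[i + ji].
  rewrite inE => Fi; have /negP := Fint _ _ Fi Fj; apply.
  rewrite disjoints_subset; apply/subsetP => _ /imsetP[a ai ->]; rewrite inE.
  apply/imsetP => -[b bj] /winj ab; subst a; move: ai bj; rewrite ji !inE /=.
  have := ltn_ord b; have := ltn_ord i => ? ?.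
  by do ?case: ifP => /=; lia.
by have := max_card (mem (K :|: sh @: K)); rewrite card_ord cardsU disjoint_setI0// cards0 subn0 card_imset//; lia.
Qed.

Section Deficient.
Variables F G : pred {set T}.
Hypothesis p_gt1 : 1 < p.
Hypothesis cardT : #|T| = n.
Hypothesis Fint : forall A B, F A -> F B -> ~~ [disjoint A & B].
Hypothesis Gint : forall A B, G A -> G B -> ~~ [disjoint A & B].
Hypothesis FG : forall A, ~~ (F A && G A).
Hypothesis full : forall w, injective w ->
  p.*2 <= #|[set j | F (arc w j)]| + #|[set j | G (arc w j)]|.

(* If the bound [arcs_intersecting] is attained everywhere, then every arrangement has exactly one
   arc in [rest]. So two members of [rest] never differ by one exchange, and exchanging the points on
   both sides of the end of an arc in [rest] puts the next disjoint arc in [rest]. Doing this with two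
   choices of the last point yields two members of [rest] which differ by one exchange. *)
Let rest (A : {set T}) := ~~ (F A || G A).

Let rest_card w : injective w -> #|[set j | rest (arc w j)]| = 1.
Proof.
move=> winj; have := full winj.
have := arcs_intersecting winj Fint; have := arcs_intersecting winj Gint.
set K := [set j | F _]; set L := [set j | G _].
have -> : [set j | rest (arc w j)] = ~: (K :|: L) by apply/setP => j; rewrite !inE.
have := cardsC (K :|: L); rewrite card_ord cardsU.
have -> : K :&: L = set0 by apply/setP => j; rewrite !inE; apply/negP/negP.
by rewrite cards0; lia.
Qed.

Let rest_uniq w i j : injective w -> rest (arc w i) -> rest (arc w j) -> i = j.
Proof.
move=> /rest_card/eqP/cards1P[k /setP kE] ri rj.
by move: (kE i) (kE j); rewrite !inE ri rj => /esym/eqP-> /esym/eqP->.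
Qed.

Let arc_comp w (s : {perm 'I_n}) j : arc (w \o s) j = w @: (s @: arc_positions j).
Proof. exact: imset_comp. Qed.

Let mem_tperm (a b i : 'I_n) (B : {set 'I_n}) : (i \in tperm a b @: B) = (tperm a b i \in B).
Proof. by rewrite -[in LHS](tpermK a b i) mem_imset//; exact: perm_inj. Qed.

Let val_tperm (a b i : 'I_n) :
  tperm a b i = (if i == a :> nat then b else if i == b :> nat then a else i) :> nat.
Proof.
case: tpermP => [->|->|/eqP + /eqP]; rewrite -?val_eqE ?eqxx//=.
  by case: eqVneq => [->|].
by move=> /negPf /= -> /negPf /= ->.
Qed.

Let tperm_cases (a b i : 'I_n) : a = i :> nat /\ tperm a b i = b :> nat \/
  b = i :> nat /\ tperm a b i = a :> nat \/
  a <> i :> nat /\ b <> i :> nat /\ tperm a b i = i :> nat.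
Proof. by rewrite val_tperm; do ?case: ifP => /=; lia. Qed.

Local Notation pos h := (Ordinal h).

Let lt0 : 0 < n. Proof. by []. Qed.
Let lt1 : 1 < n. Proof. lia. Qed.
Let ltp1 : p.-1 < n. Proof. lia. Qed.
Let ltp : p < n. Proof. lia. Qed.
Let ltpS : p.+1 < n. Proof. lia. Qed.
Let lt2p1 : p.*2.-1 < n. Proof. lia. Qed.
Let lt2p : p.*2 < n. Proof. lia. Qed.

Let swap_arc w : injective w -> rest (arc w (pos lt0)) ->
  rest (arc (w \o tperm (pos ltp1) (pos ltp)) (pos ltp)).
Proof.
move=> winj r0; set s := tperm _ _.
have inj (t : {perm 'I_n}) : injective (w \o t) by exact: inj_comp winj (@perm_inj _ t).
have [j] : exists j, j \in [set j | rest (arc (w \o s) j)].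
  by apply/set0Pn; rewrite -card_gt0 rest_card.
(* If [j] is 0, the arcs at 0 before and after the swap differ by one exchange; [t] turns them into
   the arcs at 0 and 1 of one arrangement. *)
rewrite inE => rj; have [j0|j0] := eqVneq j (pos lt0).
  pose t := tperm (pos lt0) (pos ltp1).
  have : pos lt0 = pos lt1.
    apply: (rest_uniq (inj t)); rewrite arc_comp.
      rewrite (_ : _ @: _ = arc_positions (pos lt0))//.
      by apply/setP => i; rewrite mem_tperm !inE val_tperm /=; do ?case: ifP => /=; lia.
    suff <- : s @: arc_positions (pos lt0) = t @: arc_positions (pos lt1).
      by rewrite -arc_comp -j0.
    by apply/setP => i; rewrite !mem_tperm !inE !val_tperm /=; have := ltn_ord i; do ?case: ifP => /=; lia.
  by move/(congr1 val).
have [jp|jp] := eqVneq j (pos ltp); first by rewrite -jp.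
have {}j0 : j != 0 :> nat := j0; have {}jp : j != p :> nat := jp.
(* An arc that starts neither at 0 nor at [p] contains both or neither of the swapped positions, so
   it is already an arc of [w]. *)
have := rest_uniq winj r0.
move=> /(_ j); rewrite /arc (_ : arc_positions j = s @: arc_positions j); last first.
  apply/setP => i; rewrite mem_tperm !inE val_tperm /=; have := ltn_ord j.
  by do ?case: ifP => /=; lia.
by rewrite -arc_comp => /(_ rj) e; rewrite -e in j0.
Qed.

Lemma arcs_not_full : False.
Proof.
have inj w (t : {perm 'I_n}) : injective w -> injective (w \o t).
  by move=> winj; exact: inj_comp winj (@perm_inj _ t).
have [w winj r0] : exists2 w, injective w & rest (arc w (pos lt0)).
  have c : #|T| = #|'I_n| by rewrite card_ord.
  pose w (i : 'I_n) := enum_val (cast_ord (etrans (esym (card_ord n)) (esym c)) i).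
  have winj : injective w by move=> a b /enum_val_inj/cast_ord_inj.
  have [j] : exists j, j \in [set j | rest (arc w j)].
    by apply/set0Pn; rewrite -card_gt0 rest_card.
  rewrite inE => rj.
  (* A rotation brings the arc in [rest] to position 0. *)
  have r_lt (i : 'I_n) : (if i + j < n then i + j else i + j - n) < n.
    by have := ltn_ord i; have := ltn_ord j; case: ifP; lia.
  have rinj : injective (fun i => Ordinal (r_lt i)).
    move=> a b /(congr1 val) /=; have := ltn_ord a; have := ltn_ord b.
    by move=> ? ?; do 2 case: ifP; move=> ? ? ?; apply/val_inj => /=; lia.
  exists (w \o perm rinj); first exact: inj.
  rewrite arc_comp (_ : _ @: _ = arc_positions j)//; apply/eqP.
  rewrite eqEcard card_imset ?card_arc_positions ?leqnn ?andbT; last exact: perm_inj.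
  apply/subsetP => _ /imsetP[i + ->]; rewrite !inE permE /=.
  by have := ltn_ord i; have := ltn_ord j; do ?case: ifP => /=; lia.
(* [t2] makes the second choice of the last point. [t3] exchanges positions [p] and 2p - 1, so that
   the two members of [rest] become the arcs at [p] and p + 1 of one arrangement. *)
pose s : {perm 'I_n} := tperm (pos ltp1) (pos ltp).
pose t2 : {perm 'I_n} := tperm (pos lt2p1) (pos lt2p).
pose t3 : {perm 'I_n} := tperm (pos ltp) (pos lt2p1).
have r1 := swap_arc winj r0.
have r2 : rest (arc ((w \o t2) \o s) (pos ltp)).
  apply: swap_arc; first exact: inj.
  rewrite arc_comp (_ : _ @: _ = arc_positions (pos lt0))//.
  by apply/setP => i; rewrite mem_tperm !inE val_tperm /=; have := ltn_ord i; do ?case: ifP => /=; lia.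
suff : pos ltp = pos ltpS by move/(congr1 val) => /=; lia.
apply: (rest_uniq (inj _ t3 (inj _ s winj))).
  rewrite arc_comp (_ : t3 @: _ = arc_positions (pos ltp))//.
  by apply/setP => i; rewrite mem_tperm !inE val_tperm /=; have := ltn_ord i; do ?case: ifP => /=; lia.
suff tE : t2 @: (s @: arc_positions (pos ltp)) = s @: (t3 @: arc_positions (pos ltpS)).
  have -> : arc ((w \o s) \o t3) (pos ltpS) = w @: (s @: (t3 @: arc_positions (pos ltpS))).
    by rewrite arc_comp imset_comp.
  have e2 : arc ((w \o t2) \o s) (pos ltp) = w @: (t2 @: (s @: arc_positions (pos ltp))).
    by rewrite arc_comp imset_comp.
  by rewrite -tE -e2.
apply/setP => i; rewrite !mem_tperm !mem_arc_positions/=; [|lia..].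
have := ltn_ord i; have := tperm_cases (pos ltp1) (pos ltp) (t2 i).
have := tperm_cases (pos ltp) (pos lt2p1) (s i).
have := tperm_cases (pos lt2p1) (pos lt2p) i; have := tperm_cases (pos ltp1) (pos ltp) i.
rewrite -/s -/t2 -/t3 /=; move: (nat_of_ord (s (t2 i))) (nat_of_ord (t3 (s i))) => x y.
move: (nat_of_ord (s i)) (nat_of_ord (t2 i)) (nat_of_ord i) => u v z.
clear -p_gt1; move=> s_i t2_i t3_s s_t2; case: s_i => [|[]] ?; case: t2_i => [|[]] ?;
  case: t3_s => [|[]] ?; case: s_t2 => [|[]] ?; lia.
Qed.

End Deficient.
End Arcs.

(** * Binary words read from digits in base 2h *)

Section Digits.
Variable h : nat.
Hypothesis h_gt0 : 0 < h.

Fixpoint half_digits n x : seq bool :=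
  if n is n'.+1 then (h <= x %% h.*2) :: half_digits n' (x %/ h.*2) else [::].

(* Adding [half_shift S], and possibly a carry, to a number with only such digits flips the half
   of each digit selected by [S] and cannot carry past the next digit. *)
Fixpoint carry_free n x : bool :=
  if n is n'.+1 then (x %% h.*2 %% h != h.-1) && carry_free n' (x %/ h.*2) else true.

Fixpoint half_shift (S : seq bool) : nat := if S is b :: S' then b * h + half_shift S' * h.*2 else 0.

Lemma size_half_digits n x : size (half_digits n x) = n.
Proof. by elim: n x => //= n IH x; rewrite IH. Qed.

(** Induction with an incoming carry [e], since flipping a digit of the upper half emits one. The
    excluded digits are the last of each half, whose half a carry would change. *)
Lemma half_digits_shift (S : seq bool) x e : e <= 1 -> carry_free (size S) x ->
  half_digits (size S) (x + e + half_shift S) =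
  [seq b.1 (+) b.2 | b <- zip S (half_digits (size S) x)].
Proof.
elim: S x e => //= b S IH x e e1 /andP[gx gx'].
have d_lt : x %% h.*2 < h.*2 by rewrite ltn_mod double_gt0.
set d := x %% h.*2 in gx d_lt *; set x' := x %/ h.*2 in gx' *.
have -> : x + e + (b * h + half_shift S * h.*2) = (x' + half_shift S) * h.*2 + (d + e + b * h).
  by rewrite [in LHS](divn_eq x h.*2) -/d -/x'; lia.
rewrite modnMDl divnMDl ?double_gt0//.
have gd : d + e < h.*2 /\ (h <= d + e) = (h <= d).
  have [dh|hd] := leqP h d.
    have -> : d = d - h + h by lia.
    move: gx; rewrite -(subnK dh) modnDr modn_small; lia.
  by move: gx; rewrite modn_small; lia.
case: gd => gd1 gd2; case: b => /=; rewrite ?mul1n ?mul0n ?addn0.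
  have [hd|dh] := leqP h d.
    have -> : d + e + h = 1 * h.*2 + (d + e - h) by lia.
    rewrite modnMDl divnMDl ?double_gt0// modn_small ?divn_small; [|lia..].
    rewrite addn0 addnAC IH//; congr cons; lia.
  rewrite modn_small ?divn_small; [|lia..].
  rewrite addn0 -[x' in LHS]addn0 IH//; congr cons; lia.
rewrite modn_small ?divn_small; [|lia..].
by rewrite addn0 -[x' in LHS]addn0 IH//= gd2.
Qed.

Lemma half_digits_mod n x k : half_digits n (x + k * h.*2 ^ n) = half_digits n x.
Proof.
elim: n x k => //= n IH x k.
rewrite expnSr mulnA [x + _]addnC modnMDl divnMDl ?double_gt0// [_ + x %/ _]addnC IH//.
Qed.

Lemma half_digits_modn n x : half_digits n (x %% h.*2 ^ n) = half_digits n x.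
Proof. by rewrite [in RHS](divn_eq x (h.*2 ^ n)) addnC half_digits_mod. Qed.

Lemma sum_ord_mul a b (F : nat -> nat) :
  \sum_(x < b * a) F x = \sum_(q < b) \sum_(r < a) F (q * a + r).
Proof.
elim: b => [|b IH]; first by rewrite !big_ord0.
rewrite mulSnr big_split_ord /= big_ord_recr /= -IH; congr addn.
Qed.

Lemma sum_half_digit (f : bool -> nat) :
  \sum_(r < h.*2) (r %% h != h.-1) * f (h <= r) = h.-1 * (f false + f true).
Proof.
have one : \sum_(r < h) (r != h.-1 :> nat) = h.-1.
  case: h h_gt0 => // h' _; rewrite big_ord_recr /= eqxx addn0.
  rewrite (eq_bigr (fun _ => 1)) ?sum1_card ?card_ord// => r _.
  by rewrite neq_ltn ltn_ord.
have oneM c : h.-1 * c = \sum_(r < h) (r != h.-1 :> nat) * c by rewrite -big_distrl /= one.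
rewrite -addnn big_split_ord /= mulnDr !oneM; congr addn; apply: eq_bigr => r _.
  by rewrite modn_small ?ltn_ord// [h <= r]leqNgt ltn_ord.
by rewrite modnDl modn_small ?ltn_ord// leq_addr.
Qed.

(** Each binary word of length [n] is read from (h - 1)^n carry-free numbers, as each half has h - 1
    allowed digits. *)
Lemma count_half_digits n m :
  \sum_(x < h.*2 ^ n) (carry_free n x && (count id (half_digits n x) < m)) =
  h.-1 ^ n * \sum_(j < m) 'C(n, j).
Proof.
elim: n m => [|n IH] m.
  rewrite expn0 big_ord1 /= expn0 mul1n.
  case: m => [|m]; first by rewrite big_ord0.
  by rewrite big_ord_recl /= big1.
rewrite expnSr (sum_ord_mul _ _ (fun x => carry_free n.+1 x && (count id (half_digits n.+1 x) < m))).
rewrite exchange_big /=.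
have step (r : 'I_h.*2) (q : nat) :
    (((q * h.*2 + r) %% h.*2 %% h != h.-1) && carry_free n ((q * h.*2 + r) %/ h.*2) &&
      ((h <= (q * h.*2 + r) %% h.*2) + count id (half_digits n ((q * h.*2 + r) %/ h.*2)) < m) =
    (r %% h != h.-1) * (carry_free n q && (count id (half_digits n q) < m - (h <= r))) :> nat)%N.
  rewrite modnMDl divnMDl ?double_gt0// (modn_small (ltn_ord r)) (divn_small (ltn_ord r)) addn0.
  case: (_ != _) => //=; rewrite mul1n; congr (nat_of_bool (_ && _)); lia.
under eq_bigr => r _ do (under eq_bigr => q _ do rewrite step); under eq_bigr do rewrite -big_distrr /= IH.
rewrite (sum_half_digit (fun b => h.-1 ^ n * \sum_(j < m - b) 'C(n, j))) subn0 -mulnDr mulnA -expnS.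
congr muln; case: m {step} => [|m]; first by rewrite !big_ord0.
rewrite subn1 /= big_ord_recl [in RHS]big_ord_recl /= !bin0 -addnA -big_split.
by congr addn.
Qed.

End Digits.

(** * Estimates for central binomial coefficients *)

Lemma bin_central_max n j : 'C(n.*2, j) <= 'C(n.*2, n).
Proof.
have mono i d : i + d = n -> 'C(n.*2, i) <= 'C(n.*2, n).
  elim: d i => [|d IH] i iE; first by rewrite -iE addn0.
  apply: leq_trans (IH i.+1 _); last lia.
  rewrite -(leq_pmul2l (ltn0Sn i)) mul_bin_left leq_mul2r; lia.
have [jn|nj] := leqP j n; first exact: (mono j (n - j)) (subnKC jn).
have [j2|j2] := leqP j n.*2; last by rewrite bin_small.
rewrite -bin_sub//; apply: (mono _ (j - n)); lia.
Qed.

(** Induction through the ratio 2(2n + 1)/(n + 1) of consecutive central coefficients and (2n +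
    1)(2n + 3) <= (2n + 2)^2. *)
Lemma bin_central_sqr n : 'C(n.*2, n) ^ 2 * n.*2.+1 <= 4 ^ n.*2.
Proof.
elim: n => // n IH.
have E : n.+1 * 'C(n.+1.*2, n.+1) = 2 * (n.*2.+1 * 'C(n.*2, n)).
  have := mul_bin_down n.*2.+1 n; rewrite doubleS binS /= => ->.
  rewrite (_ : 'C(n.*2.+1, n.+1) = 'C(n.*2.+1, n)); last first.
    by rewrite -bin_sub; [congr binomial; lia|lia].
  by rewrite (_ : n.*2.+1 - n = n.+1); lia.
rewrite -(leq_pmul2l (_ : 0 < n.+1 ^ 2)) ?expn_gt0// mulnA -expnMn E.
rewrite (_ : 4 ^ _ = 16 * 4 ^ n.*2); last by rewrite doubleS !expnS mulnA.
rewrite !expnMn.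
have e (a b c : nat) : 2 ^ 2 * (b ^ 2 * a ^ 2) * c = a ^ 2 * b * (4 * b * c).
  by ring.
rewrite e.
rewrite (_ : n.+1 ^ 2 * _ = 4 ^ n.*2 * (16 * n.+1 ^ 2)); last by ring.
by apply: leq_mul => //; rewrite -mulnn; nia.
Qed.

(** By symmetry, 2^(2n) is twice the lower tail plus s + 1 middle terms, each at most 2^(2n) / ((s +
    1) D) by [bin_central_sqr]. *)
Lemma sum_bin_lower_half m s n D : n.*2 = m.*2 + s -> (s.+1 * D) ^ 2 <= n.*2.+1 ->
  D * 2 ^ n.*2 <= (D * \sum_(j < m) 'C(n.*2, j)).*2 + 2 ^ n.*2.
Proof.
move=> nE hD; set N := n.*2 in nE hD *.
have tot : 2 ^ N = (\sum_(j < m) 'C(N, j)).*2 + \sum_(j < s.+1) 'C(N, m + j).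
  rewrite -[2 ^ N]/((1 + 1) ^ N) expnDn (eq_bigr (fun i : 'I_N.+1 => 'C(N, i))); last first.
    by move=> i _; rewrite !exp1n !muln1.
  have -> : N.+1 = m + s.+1 + m by lia.
  rewrite !big_split_ord /= -addnn addnAC; congr (_ + _ + _).
  rewrite [LHS](reindex_inj rev_ord_inj) /=; apply: eq_bigr => i _.
  by rewrite -bin_sub; [congr binomial|]; have := ltn_ord i; lia.
have mid : \sum_(j < s.+1) 'C(N, m + j) <= s.+1 * 'C(N, n).
  rewrite -[X in X * _]card_ord -sum_nat_const; apply: leq_sum => j _; exact: bin_central_max.
have c : s.+1 * D * 'C(N, n) <= 2 ^ N.
  rewrite -leq_sqr (_ : (2 ^ N) ^ 2 = 4 ^ N); last by rewrite -expnM mulnC expnM.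
  rewrite expnMn mulnC; apply: leq_trans (bin_central_sqr n).
  by rewrite leq_mul2l hD orbT.
rewrite {1}tot mulnDr -doubleMr leq_add2l; apply: leq_trans c.
by rewrite mulnAC [s.+1 * _ * _]mulnC leq_mul2l mid orbT.
Qed.

From mathcomp Require Import all_classical all_reals all_analysis.
From mathcomp Require Import measurable_realfun.
Import Order.TTheory GRing.Theory Num.Theory.
Import numFieldNormedType.Exports.
Local Open Scope classical_set_scope.
Local Open Scope ring_scope.

(** * Translation and averaging on the circle *)

Section CircleBases.
Context (R : realType).
Implicit Types (A : set (circle R)) (t : circle R).

Lemma open_circle A : open (@to_circle R @^-1` A) -> open A.
Proof. by []. Qed.

Lemma measurable_open_circle A : open A -> measurable A.
Proof. by move=> oA; rewrite measurable_circleE; exact: sub_sigma_algebra. Qed.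

Lemma to_circle_repr t : to_circle (repr t) = t.
Proof. exact: reprK. Qed.

Lemma translateE A t : translate A t = (fun x => x - t) @^-1` A.
Proof.
apply/seteqP; split => [_ [a Aa <-]|x Ax]; first by rewrite /preimage/= addrK.
by exists (x - t); rewrite ?subrK.
Qed.

Lemma measurable_translate A t : measurable A -> measurable (translate A t).
Proof.
move=> mA; rewrite translateE -[X in measurable X]setTI.
suff mf : measurable_fun [set: circle R] (fun x => x - t) by exact: mf.
apply: (@measurability _ _ (circle R) (circle R) setT (fun x => x - t) (@open (circle R))) => //.
move=> _ [U oU <-]; rewrite setTI; apply: measurable_open_circle; apply: open_circle.
(* Openness in the quotient is tested on the line, to which the translation lifts. *)
rewrite (_ : _ @^-1` _ = (fun y => y - repr t) @^-1` (@to_circle R @^-1` U)).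
  apply: open_comp; last exact: oU.
  by move=> y _; apply: cvgB; [exact: cvg_id|exact: cvg_cst].
apply/funext => y; rewrite /preimage/=; congr U.
by apply: (addIr (to_circle (repr t))); rewrite -to_circleD to_circle_repr !subrK.
Qed.

(** Integrate the number of indices [i] with [x] in [E i] against the probability measure. *)
Lemma haar_average (I : finType) (E : I -> set (circle R)) (a : \bar R) (K : nat) :
  (forall i, measurable (E i)) -> (forall i, haar (E i) = a) ->
  (forall x, (#|[set i | x \in E i]%SET| <= K)%N) -> ((#|I|%:R)%:E * a <= K%:R%:E)%E.
Proof.
move=> mE Ea EK.
pose mu : {measure set (circle R) -> \bar R} := @haar R.
have muE i : mu (E i) = a by exact: Ea.
have mf i : measurable_fun [set: circle R] (EFin \o (\1_(E i) : circle R -> R)).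
  by apply/measurable_EFinP; exact: measurable_indic.
have <- : (\int[mu]_x (\sum_(i <- index_enum I) (EFin \o \1_(E i)) x) = #|I|%:R%:E * a)%E.
  rewrite ge0_integral_sum//; last by move=> i x _; rewrite lee_fin.
  under eq_bigr => i _ do rewrite /= integral_indic// setIT muE.
  by rewrite sumr_const mule_natl.
have -> : K%:R%:E = (\int[mu]_x (cst K%:R%:E x))%E.
  by rewrite integral_cst// (_ : mu setT = 1%E) ?mule1//; exact: (@probability_setT _ _ _ (@haar R)).
apply: ge0_le_integral => //.
- by move=> x _; apply: sume_ge0 => i _; rewrite lee_fin.
- by apply: emeasurable_sum.
- move=> x _ /=; rewrite sumEFin lee_fin.
  apply: le_trans (_ : #|[set i | x \in E i]%SET|%:R <= _); last by rewrite ler_nat.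
  rewrite -sum1_card natr_sum [leRHS]big_mkcond/=; apply: ler_sum => i _.
  by rewrite inE indicE; case: ifP.
Qed.

End CircleBases.

(** * Coloring bases from sets of residues modulo [Q] *)

Section CyclicBase.
Context (R : realType) (G : sgraph).
Variables (Q : nat) (B : pred nat) (t : vertex G -> nat).
Hypothesis Q_gt0 : (0 < Q)%N.
Hypothesis B_disjoint : forall u v, edge u v -> forall x y, B x -> B y ->
  x + t u <> y + t v %[mod Q].

(** Open intervals make the union [A] open, hence Borel, and omit only endpoints. *)
Let arc i := `](i%:R / Q%:R : R), (i.+1%:R / Q%:R)[%classic.

Let A : set (circle R) := \bigcup_(i in [set i | (i < Q)%N && B i]) (@to_circle R @` arc i).

Let Q0 : (0 : R) < Q%:R. Proof. by rewrite ltr0n. Qed.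

Let openA : open A.
Proof.
apply: open_circle; rewrite (_ : _ @^-1` _ =
    \bigcup_(j in [set j : int * nat | (j.2 < Q)%N && B j.2])
       ((fun y : R => y - j.1%:~R) @^-1` arc j.2)).
  apply: bigcup_open => -[n i] _ /=; apply: open_comp; last exact: interval_open.
  by move=> y _; apply: cvgB; [exact: cvg_id|exact: cvg_cst].
apply/seteqP; split=> y /=.
  move=> [i Bi [x xi /to_circle_eq[n xy]]]; exists (- n, i) => //=.
  by rewrite (_ : y - _ = x)// rmorphN/= -xy; ring.
move=> [[n i] /= Bi yi]; exists i => //; exists (y - n%:~R) => //.
by apply/to_circle_eq; exists (- n); rewrite rmorphN/=; ring.
Qed.

Let baseA : coloring_base G A.
Proof.
exists (fun v => to_circle ((t v)%:R / Q%:R : R)) => u v uv.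
apply/seteqP; split=> // _ [[_ [i Bi [x xi <-]] <-] [_ [j Bj [y yj <-]]]].
rewrite -!to_circleD => /to_circle_eq[n nE].
have [/andP[_ {}Bi] /andP[_ {}Bj]] := (Bi, Bj).
apply: (B_disjoint uv Bi Bj).
suff e : j%:Z + (t v)%:Z = i%:Z + (t u)%:Z + n * Q%:Z.
  by apply/eqP; rewrite -eqz_nat -!modz_nat !PoszD e [_ + n * _]addrC modzMDl eqxx.
have itvQ k (z : R) : arc k z -> k%:R < z * Q%:R < k%:R + 1.
  by rewrite /arc /= in_itv/= ltr_pdivrMr// ltr_pdivlMr// -natr1.
move: (itvQ _ _ xi) (itvQ _ _ yj) => /andP[ix xi1] /andP[jy yj1].
have {}nE : y * Q%:R + (t v)%:R - (x * Q%:R + (t u)%:R) = n%:~R * Q%:R.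
  by rewrite -nE; field; rewrite gt_eqF.
(* Scaled by [Q], each point exceeds its index by less than 1; the resulting integer lies strictly
   between -1 and 1, so it is 0. *)
have /andP[] : -1 < ((j%:Z + (t v)%:Z - (i%:Z + (t u)%:Z + n * Q%:Z))%:~R : R) < 1.
  by rewrite !(rmorphB, rmorphD, rmorphM)/= -nE -!pmulrn; lra.
by rewrite -[-1]/((-1)%:~R) -[1]/(1%:~R) !ltr_int; lia.
Qed.

Lemma cyclic_base : exists A : set (circle R),
  [/\ measurable A, coloring_base G A &
      ((\sum_(x < Q) B x)%:R / Q%:R)%:E <= haar A]%E.
Proof.
exists A; split; [exact: measurable_open_circle|exact: baseA|].
pose mu : {measure set (measurableTypeR R) -> \bar R} := lebesgue_measure.
have trivarc : trivIset setT (fun i : 'I_Q => arc i).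
  apply/trivIsetP => i j _ _ ij; apply/seteqP; split=> // x [xi xj].
  have itvQ (k : nat) (z : R) : arc k z -> k%:R < z * Q%:R < k.+1%:R.
    by rewrite /arc /= in_itv/= ltr_pdivrMr// ltr_pdivlMr.
  move: (itvQ _ _ xi) (itvQ _ _ xj) => /andP[a b] /andP[c d].
  have := lt_trans a d; have := lt_trans c b; rewrite !ltr_nat.
  by move: ij; rewrite -val_eqE /=; lia.
have muarc (i : 'I_Q) : mu (arc i) = (Q%:R^-1)%:E.
  rewrite -[mu _]/(lebesgue_measure (`](i%:R / Q%:R : R), (i.+1%:R / Q%:R)[%classic : set R)).
  rewrite lebesgue_measure_itv/= lte_fin ltr_pM2r ?invr_gt0// ltr_nat leqnn.
  by rewrite -EFinD -mulrBl -natrB// subSnn mul1r.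
have -> : ((\sum_(x < Q) B x)%:R / Q%:R)%:E = mu (\big[setU/set0]_(i < Q | B i) arc i).
  rewrite measure_bigsetU_ord//; last by move=> i; exact: measurable_itv.
  rewrite (eq_bigr (fun=> (Q%:R^-1)%:E)); last by move=> i _; exact: muarc.
  rewrite sumEFin natr_sum mulr_suml [in RHS]big_mkcond/=; congr EFin.
  by apply: eq_bigr => i _; case: (B i); rewrite ?mul1r ?mul0r.
rewrite /haar /pushforward /mrestr; apply: le_measure; rewrite ?inE.
- by apply: bigsetU_measurable => i _; exact: measurable_itv.
- apply: measurableI; last exact: measurable_itv.
  rewrite -[X in measurable X]setTI; apply: measurable_to_circle => //.
  exact: measurable_open_circle.
rewrite -bigcup_seq_cond => x [i /= /andP[_ Bi] xi]; split.
  by exists i => /=; [rewrite ltn_ord|exists x].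
move: xi; rewrite /arc /= !in_itv/= => /andP[ix xi].
rewrite (le_trans _ (ltW ix)) ?divr_ge0 ?ler0n//= (lt_le_trans xi)//.
by rewrite ler_pdivrMr// mul1r ler_nat ltn_ord.
Qed.

End CyclicBase.

(** * Coloring bases for graphs mapped to a Kneser graph *)

(** The sum modulo 2 of [S] and [S'] equals that of [a] and [b]; by disjointness the former has the
    full weight of both. *)
Lemma count_addb_disjoint (S S' a b : seq bool) :
  size S = size S' -> size a = size S -> size b = size S -> all (fun x => ~~ (x.1 && x.2)) (zip S S') ->
  [seq x.1 (+) x.2 | x <- zip S a] = [seq x.1 (+) x.2 | x <- zip S' b] ->
  (count id S + count id S' <= count id a + count id b)%N.
Proof.
elim: S S' a b => [|x S IH] [|x' S'] [|y a] [|y' b]//= [sS] [sa] [sb] /andP[xx' d] [yy' e].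
by have := IH _ _ _ sS sa sb d e; move: xx' yy'; case: x x' y y' => -[] [] []//=; lia.
Qed.

Section KneserBase.
Context (R : realType) (G : sgraph).
Variables (T : finType) (m h : nat) (phi : vertex G -> {set T}).
Hypothesis h_gt0 : (0 < h)%N.
Hypothesis phi_card : forall v, #|phi v| = m.
Hypothesis phi_edge : forall u v, edge u v -> [disjoint phi u & phi v]%B.

Let bits v := [seq i \in phi v | i <- enum T].

Let size_bits v : size (bits v) = #|T|.
Proof. by rewrite size_map cardE. Qed.

Let count_bits v : count id (bits v) = m.
Proof. by rewrite count_map -(phi_card v) cardE -size_filter enumT. Qed.

Let B x := carry_free h #|T| x && (count id (half_digits h #|T| x) < m)%N.

(** A coincidence between the translates for an edge would force two words of weight below [m] to
    have total weight at least 2m. *)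
Lemma kneser_base : exists A : set (circle R),
  [/\ measurable A, coloring_base G A &
     ((h.-1 ^ #|T| * \sum_(j < m) 'C(#|T|, j))%:R / (h.*2 ^ #|T|)%:R)%:E <= haar A]%E.
Proof.
rewrite -(count_half_digits h_gt0).
apply: (@cyclic_base R G (h.*2 ^ #|T|) B (fun v => half_shift h (bits v))).
  by rewrite expn_gt0 double_gt0 h_gt0.
move=> u v uv x y /andP[gx cx] /andP[gy cy] xy.
have := congr1 (half_digits h #|T|) xy; rewrite !half_digits_modn//.
have sh w z : carry_free h #|T| z -> half_digits h #|T| (z + half_shift h (bits w)) =
    [seq b.1 (+) b.2 | b <- zip (bits w) (half_digits h #|T| z)].
  by have := half_digits_shift h_gt0 (S := bits w) (x := z) (leq0n 1); rewrite size_bits addn0.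
rewrite !sh// => /count_addb_disjoint.
rewrite !size_bits !size_half_digits !count_bits => /(_ erefl erefl erefl) le2.
suff /le2 : all (fun x => ~~ (x.1 && x.2)) (zip (bits u) (bits v)) by lia.
rewrite zip_map all_map; apply/allP => i _ /=; apply/negP => /andP[iu iv].
by have /pred0P/(_ i) := phi_edge uv; rewrite /= iu iv.
Qed.

End KneserBase.

(** * General bounds on the three invariants *)

Section GraphInvariants.
Context (R : realType) (G : sgraph).

(** Each point of [T] gives weight 1/m to its star. Different points may have the same star, so [w]
    sums over points. *)
Lemma fractional_chromatic_number_le (T : finType) (m : nat) (phi : vertex G -> {set T}) :
    (0 < m)%N -> (forall v, #|phi v| = m) ->
    (forall u v, edge u v -> [disjoint phi u & phi v]%B) ->
  fractional_chromatic_number R G <= #|T|%:R / m%:R.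
Proof.
move=> m_gt0 phi_card phi_edge; have [_ lbE] := fractional_chromatic_numberP R G.
apply: lbE; pose star i := [set v | i \in phi v]%SET.
have star_ind i : independent (star i).
  apply/forall_inP => u; rewrite inE => iu; apply/forall_inP => v; rewrite inE => iv.
  by apply/negP => /phi_edge/pred0P/(_ i); rewrite /= iu iv.
pose w I : R := \sum_(i : T) (star i == I)%:R / m%:R.
have sum_w (P : pred {set vertex G}) :
    \sum_(I : {set vertex G} | P I) w I = \sum_(i | P (star i)) m%:R^-1.
  rewrite exchange_big /= [in RHS]big_mkcond /=; apply: eq_bigr => i _.
  case: ifPn => [Pi|nPi].
    rewrite (bigD1 (star i))//= eqxx mul1r big1 ?addr0// => I /andP[_ /negPf].
    by rewrite eq_sym => ->; rewrite mul0r.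
  by rewrite big1// => I PI; case: eqP => [e|]; [rewrite e PI in nPi|rewrite mul0r].
exists w; split.
- by move=> I _; apply: sumr_ge0 => i _; rewrite divr_ge0.
- move=> v; rewrite (sum_w (fun I => independent I && (v \in I))).
  rewrite (eq_bigl (mem (phi v))); last by move=> i; rewrite star_ind inE.
  by rewrite sumr_const phi_card -[_ *+ m]mulr_natl divff// pnatr_eq0 -lt0n.
- rewrite (sum_w (@independent G)) (eq_bigl predT)//.
  by rewrite sumr_const -[_ *+ #|_|]mulr_natl.
Qed.

Lemma fine_haar (A : set (circle R)) : measurable A -> (fine (haar A))%:E = haar A.
Proof. by move=> mA; rewrite fineK//; exact: (fin_num_measure (@haar R)). Qed.

Lemma sigma_circle_ge (A : set (circle R)) : measurable A -> coloring_base G A ->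
  fine (haar A) <= sigma_circle R G.
Proof.
move=> mA bA; apply: sup_upper_bound; last by exists A.
split; first by exists (fine (haar A)), A.
exists 1 => _ [B [mB _] <-]; rewrite -lee_fin fine_haar//.
exact: (@probability_le1 _ _ _ (@haar R)).
Qed.

Lemma sigma_circle_le (c : R) : 0 <= c ->
  (forall A : set (circle R), measurable A -> coloring_base G A -> (haar A <= c%:E)%E) ->
  sigma_circle R G <= c.
Proof.
move=> c0 hc; rewrite /sigma_circle; set E := [set _ | _ in _].
(* The supremum of the empty set is 0 by convention, which is where [0 <= c] enters. *)
have [->|/set0P E0] := eqVneq E set0; first by rewrite sup0.
by apply: ge_sup => // _ [A [mA bA] <-]; rewrite -lee_fin fine_haar//; exact: hc.
Qed.

Lemma circular_chromatic_numberE (z : R) (f : vertex G -> R) : circular_coloring z f ->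
    (forall z' (f' : vertex G -> R), circular_coloring z' f' -> z <= z') ->
  circular_chromatic_number R G = z.
Proof.
move=> zf zmin; rewrite /circular_chromatic_number /minimum.
set E := [set z' | exists f' : vertex G -> R, circular_coloring z' f'].
have [[f' /zmin zle] lb] : (E `&` lbound E) (get (E `&` lbound E)).
  by apply: getPex; exists z; split => [|z' [f' /zmin]//]; exists f.
by apply/eqP; rewrite eq_le zle andbT; apply: lb; exists f.
Qed.

End GraphInvariants.

(** * Lower bound on circular colorings *)

Section CircularLowerBound.
Context (R : realType).

(** Points of the same unit interval are less than 1 apart, so [a] is a bijection. Ordered by
    intervals, the sum of the two points grows by at least 2 per step, hence by 2(q - 1) in all; the
    upper bounds for the extreme intervals limit this growth to 2(z - 1). *)
Lemma zigzag_circular (q : nat) (x y : 'I_q -> R) (a : 'I_q -> 'I_q) (z : R) : (1 < q)%N ->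
    (forall i, (a i)%:R <= x i < (a i)%:R + 1) -> (forall i, (a i)%:R <= y i < (a i)%:R + 1) ->
    (forall i j, i != j -> 1 <= `|x i - y j| <= z - 1) ->
  q%:R <= z.
Proof.
move=> q1 ax ay xy.
have ainj : injective a.
  move=> i j aij; apply/eqP; apply: contraT => /xy/andP[+ _].
  rewrite leNgt => /negP[]; rewrite ltr_norml; move: (ax i) (ay j); rewrite aij; lra.
have [b ba ab] := injF_bij ainj.
pose X (k : 'I_q) := x (b k); pose Y (k : 'I_q) := y (b k).
have bX (k : 'I_q) : k%:R <= X k < k%:R + 1 by have := ax (b k); rewrite ab.
have bY (k : 'I_q) : k%:R <= Y k < k%:R + 1 by have := ay (b k); rewrite ab.
have bne k l : k != l -> b k != b l by apply: contra_neq => /(congr1 a); rewrite !ab.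
(* [X] and [Y] are handled together, since [X l] is only bounded below by [Y k]. *)
have step (k l : 'I_q) : l = k.+1 :> nat -> X k + Y k + 2 <= X l + Y l.
  move=> lk; have kl : k != l by rewrite -val_eqE /= lk neq_ltn ltnSn.
  have := xy _ _ (bne _ _ kl); rewrite eq_sym in kl; have := xy _ _ (bne _ _ kl).
  rewrite -/(X l) -/(Y k) -/(X k) -/(Y l).
  move: (bX l) (bY k) (bX k) (bY l); rewrite lk -natr1.
  move=> /andP[? ?] /andP[? ?] /andP[? ?] /andP[? ?].
  by rewrite gtr0_norm ?ltr0_norm ?subr_gt0 ?subr_lt0; lra.
have chain (k : 'I_q) (o : 'I_q) : o = 0%N :> nat -> X o + Y o + 2 * k%:R <= X k + Y k.
  move=> o0; case: k => k; elim: k => [|k IH] kq.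
    by rewrite mulr0 addr0 (_ : Ordinal kq = o)//; apply/val_inj.
  have := IH (ltnW kq); have := step (Ordinal (ltnW kq)) (Ordinal kq) erefl.
  by rewrite /= -natr1; lra.
have q0 : (0 < q)%N by exact: ltnW.
have ql : (q.-1 < q)%N by rewrite prednK.
pose o := Ordinal q0; pose l := Ordinal ql.
have ol : o != l by rewrite -val_eqE /=; lia.
have := chain l o erefl; have := xy _ _ (bne _ _ ol); rewrite eq_sym in ol.
have := xy _ _ (bne _ _ ol); rewrite -/(X l) -/(X o) -/(Y l) -/(Y o).
rewrite !ler_norml /= => /andP[_ /andP[_ h1]] /andP[_ /andP[h2 _]].
have -> : (q%:R : R) = q.-1%:R + 1 by rewrite natr1 prednK.
lra.
Qed.

Lemma circular_lower_bound (T : finType) (m s q : nat) (f : {set T} -> 'I_q -> R) (z : R) :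
    (0 < m)%N -> #|T| = (m.*2 + s)%N -> (1 < q)%N -> (q ^ q < s.+2)%N ->
    (forall X : {set T}, #|X| = m -> forall i, 0 <= f X i < z) ->
    (forall X Y : {set T}, #|X| = m -> #|Y| = m -> [disjoint X & Y]%B -> forall i j, i != j ->
       1 <= `|f X i - f Y j| <= z - 1) ->
  q%:R <= z.
Proof.
move=> m_gt0 cT q1 qs fz ff; rewrite leNgt; apply/negP => zq.
have q0 : (0 < q)%N by exact: ltnW.
(* Since [z] is below [q], so are the integral parts for [m]-sets, and the default of [insubd] does
   not occur there. *)
pose a (X : {set T}) (i : 'I_q) : 'I_q := insubd (Ordinal q0) `|Num.floor (f X i)|%N.
have aE (X : {set T}) i : #|X| = m -> (a X i)%:R <= f X i < (a X i)%:R + 1.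
  move=> /fz/(_ i)/andP[f0 fl].
  have fE : ((`|Num.floor (f X i)|%N)%:R : R) = (Num.floor (f X i))%:~R.
    by rewrite natr_absz ger0_norm// floor_ge0.
  have lt : (`|Num.floor (f X i)| < q)%N.
    by rewrite -(ltr_nat R) fE (le_lt_trans (floor_le _))// (lt_trans fl).
  by rewrite /a val_insubd lt fE floor_le/= -[1]/(1%:~R) -intrD floorD1_gt.
move: qs; rewrite ltnNge => /negP; apply.
apply: (@kneser_chromatic T m s (q ^ q) (fun X => enum_rank [ffun i => a X i])) => //.
  by move=> X _; rewrite (leq_trans (ltn_ord _))// card_ffun card_ord.
move=> X Y cX cY dXY; apply/eqP => /val_inj/enum_rank_inj/ffunP aXY.
have : q%:R <= z.
  apply: (@zigzag_circular q (f X) (f Y) (a X) z) => // [i|i|i j ij].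
  - exact: aE.
  - by have := aXY i; rewrite !ffunE => ->; exact: aE.
  - exact: ff.
by rewrite leNgt zq.
Qed.

End CircularLowerBound.

(** * Strict upper bound on bases for graphs receiving the Kneser graph of p-sets of 2p + 1
    points *)

Section OddKneser.
Context (R : realType) (G : sgraph) (p : nat).
Local Notation n := p.*2.+1.
Variable g : {set 'I_n} -> vertex G.
Hypothesis p_gt1 : (1 < p)%N.
Hypothesis g_edge : forall S S' : {set 'I_n}, #|S| = p -> #|S'| = p ->
  [disjoint S & S']%B -> edge (g S) (g S').

Section Base.
Variables (A : set (circle R)) (f : vertex G -> circle R).
Hypothesis mA : measurable A.
Hypothesis fA : forall u v, edge u v -> translate A (f u) `&` translate A (f v) = set0.

Let S0 : {set 'I_n} := arc_positions ord0.
Let lt_p_n : (p < n)%N. Proof. by lia. Qed.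
Let S1 : {set 'I_n} := arc_positions (Ordinal lt_p_n).

(** The arcs [S0] and [S1] are disjoint, so their images are adjacent, and [A] is disjoint from its
    translate by [d]. *)
Let d := f (g S1) - f (g S0).

Let transl (b : bool) (S : {set 'I_n}) := translate A (f (g S) + (if b then d else 0)).

Let member (x : circle R) (b : bool) : pred {set 'I_n} :=
  [pred S : {set 'I_n} | (#|S| == p) && (x \in transl b S)].

Let transl_disjoint b (S S' : {set 'I_n}) x : #|S| = p -> #|S'| = p ->
  x \in transl b S -> x \in transl b S' -> ~~ [disjoint S & S']%B.
Proof.
move=> cS cS'; rewrite !inE /transl !translateE /preimage/= => xS xS'; apply/negP => /(g_edge cS cS')/fA.
rewrite !translateE => /seteqP[+ _]; move=> /(_ (x - (if b then d else 0))); apply.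
by split; rewrite /preimage/= -addrA -opprD [X in A (x - X)]addrC.
Qed.

Let transl_d (S : {set 'I_n}) x : x \in transl false S -> x \notin transl true S.
Proof.
rewrite inE /transl translateE /preimage/= addr0 => xS; apply/negP; rewrite inE translateE /preimage/= => xS'.
have : edge (g S0) (g S1).
  apply: g_edge; rewrite ?card_arc_positions//.
  by apply/pred0P => i /=; rewrite !mem_arc_positions/=; lia.
move/fA; rewrite !translateE => /seteqP[+ _]; move=> /(_ (x - f (g S) + f (g S0))); apply.
split; rewrite /preimage/=; first by rewrite addrK.
rewrite (_ : _ - _ = x - (f (g S) + d))//.
by rewrite /d opprD opprB !addrA.
Qed.

Let count (x : circle R) (w : {perm 'I_n}) :=
  (\sum_(b : bool) #|[set j | member x b (arc w j)]%SET|)%N.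

Let count_le x w : (count x w <= p.*2)%N.
Proof.
rewrite /count big_bool -[leqRHS]addnn.
by apply: leq_add; (apply: arcs_intersecting; [exact: perm_inj|]);
  move=> S S' /andP[/eqP cS xS] /andP[/eqP cS' xS']; exact: transl_disjoint xS xS'.
Qed.

(** Each arrangement counts at most 2p, and [arcs_not_full] provides one that counts less. *)
Let sum_count_lt x : (\sum_(w : {perm 'I_n}) count x w < #|{perm 'I_n}| * p.*2)%N.
Proof.
have [/forallP full|] := boolP [forall w : {perm 'I_n}, p.*2 <= count x w]%N.
  exfalso; apply: (@arcs_not_full 'I_n p (member x true) (member x false)) => //.
  - exact: card_ord.
  - by move=> S S' /andP[/eqP cS xS] /andP[/eqP cS' xS']; exact: transl_disjoint xS xS'.
  - by move=> S S' /andP[/eqP cS xS] /andP[/eqP cS' xS']; exact: transl_disjoint xS xS'.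
  - by move=> S; apply/negP => /andP[/andP[_ xt] /andP[_ /transl_d]]; rewrite xt.
  - move=> w winj; have := full (perm winj); rewrite /count big_bool /=.
    have aw j : arc (perm winj) j = arc w j by apply: eq_imset => i; rewrite permE.
    have e b : #|[set j | member x b (arc (perm winj) j)]%SET| =
        #|[set j | member x b (arc w j)]%SET|.
      by apply: eq_card => j; rewrite !inE aw.
    by rewrite !e.
rewrite negb_forall => /existsP[w0]; rewrite -ltnNge => lt0.
rewrite (bigD1 w0)//= -sum_nat_const [X in (_ < X)%N](bigD1 w0)//= -addSn leq_add//.
by apply: leq_sum => w _.
Qed.

(** [N] is the number of triples of an arrangement, a starting position and a family; [K] bounds the
    number of those whose translate of [A] contains a given point. *)
Let K := (#|{perm 'I_n}| * p.*2).-1.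
Let N := (#|{perm 'I_n}| * n * 2)%N.

Let perm_gt0 : (0 < #|{perm 'I_n}|)%N.
Proof. by apply/card_gt0P; exists 1%g. Qed.

Lemma odd_kneser_base_le : (haar A <= (K%:R / N%:R)%:E)%E.
Proof.
pose E (i : {perm 'I_n} * 'I_n * bool) := transl i.2 (arc i.1.1 i.1.2).
have mE i : measurable (E i) by exact: measurable_translate.
have aE i : haar (E i) = haar A by exact: haar_translate.
have EK x : (#|[set i | x \in E i]%SET| <= K)%N.
  have := sum_count_lt x; rewrite (_ : (\sum_(w : {perm 'I_n}) _)%N = #|[set i | x \in E i]%SET|).
    by rewrite /K; have := perm_gt0; case: (_ * _)%N.
  rewrite -sum1_card [RHS]big_mkcond/= (eq_bigr (fun i => x \in E i : nat)); last first.
    by move=> i _; rewrite inE; case: (_ \in _).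
  rewrite -(pair_bigA _ (fun wj b => x \in E (wj, b) : nat))/=.
  rewrite -(pair_bigA _ (fun w j => \sum_b (x \in E (w, j, b) : nat))%N)/=.
  apply: eq_bigr => w _; rewrite exchange_big/=; apply: eq_bigr => b _.
  rewrite -sum1_card big_mkcond/=; apply: eq_bigr => j _.
  rewrite inE /member/= card_arc ?eqxx; last exact: perm_inj.
  by rewrite /E /=; case: (x \in _).
have := haar_average mE aE EK; rewrite -(fine_haar mA) -EFinM !lee_fin.
rewrite !card_prod card_ord card_bool -/N => h.
by rewrite ler_pdivlMr ?ltr0n ?muln_gt0 ?perm_gt0// mulrC.
Qed.

End Base.

(** The bound K / N of [odd_kneser_base_le] is the same for every base, so strictness survives the
    supremum. *)
Lemma odd_kneser_sigma_lt : sigma_circle R G < p%:R / n%:R.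
Proof.
have m0 : (0 < #|{perm 'I_n}|)%N by apply/card_gt0P; exists 1%g.
set K := ((#|{perm 'I_n}| * p.*2).-1%:R / (#|{perm 'I_n}| * n * 2)%:R : R).
apply: (@le_lt_trans _ _ K).
  apply: sigma_circle_le => [|A mA [f fA]]; first by rewrite divr_ge0.
  exact: odd_kneser_base_le mA fA.
rewrite /K ltr_pdivrMr ?ltr0n ?muln_gt0 ?m0// mulrAC ltr_pdivlMr ?ltr0n//.
rewrite -!natrM ltr_nat; move: m0; set M := #|_|; move: M => M M0.
have -> : (p * (M * n * 2) = M * p.*2 * n)%N by rewrite -muln2; lia.
by rewrite ltn_pmul2r// prednK// muln_gt0 M0 double_gt0; lia.
Qed.

End OddKneser.

Lemma bernoulli_ineq (R : realDomainType) (x : R) (k : nat) : 0 <= x <= 1 -> 1 - k%:R * x <= (1 - x) ^+ k.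
Proof.
move=> /andP[x0 x1]; elim: k => [|k IH]; first by rewrite mul0r subr0 expr0.
have : (1 - x) * (1 - k%:R * x) <= (1 - x) ^+ k.+1 by rewrite exprS ler_wpM2l// subr_ge0.
apply: le_trans; rewrite -natr1; have : 0 <= k%:R * x * x by rewrite !mulr_ge0.
nra.
Qed.

(** * The graphs and their invariants *)

Section Witness.
Variables p s q : nat.
Local Notation n := p.*2.+1.
Let ground := ('I_n * 'I_s)%type.

Let odd_vertex := {S : {set 'I_n} | #|S| == p}.
Let big_vertex := {X : {set ground} | #|X| == (p * s)%N}.

(** The conjunct [u != v] ensures irreflexivity even for p = 0, where the empty set is disjoint from
    itself. *)
Definition witness_rel (u v : odd_vertex + big_vertex * 'I_q) : bool :=
  (u != v) && match u, v with
  | inl A, inl B => [disjoint val A & val B]%B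
  | inr (X, i), inr (Y, j) => [disjoint val X & val Y]%B && (i != j)
  | _, _ => false
  end.

Lemma witness_sym : symmetric witness_rel.
Proof.
move=> [S|[X i]] [S'|[Y j]]; rewrite /witness_rel eq_sym//= disjoint_sym//.
by rewrite (eq_sym i).
Qed.

Lemma witness_irrefl : irreflexive witness_rel.
Proof. by move=> u; rewrite /witness_rel eqxx. Qed.

Definition witness := SGraph witness_sym witness_irrefl.

Context (R : realType).
Hypothesis p_gt1 : (1 < p)%N.
Hypothesis s_gt0 : (0 < s)%N.

Let ground_proj (v : vertex witness) : {set ground} :=
  match v with inl A => finset.setX (val A) [set: 'I_s]%SET | inr (X, _) => val X end.

Let ground_card v : #|ground_proj v| = (p * s)%N.
Proof.
case: v => [S|[X i]] /=; last exact/eqP/(valP X).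
by rewrite cardsX cardsT card_ord (eqP (valP S)).
Qed.

Let ground_edge u v : edge u v -> [disjoint ground_proj u & ground_proj v]%B.
Proof.
case: u v => [S|[X i]] [S'|[Y j]] //= /andP[_] //; last by case/andP.
move=> dS; apply/pred0P => -[a b] /=; rewrite !finset.inE !andbT.
by have /pred0P/(_ a) := dS.
Qed.

Let ground_size : #|{: ground}| = ((p * s).*2 + s)%N.
Proof. by rewrite card_prod !card_ord; lia. Qed.

Lemma witness_fractional :
  fractional_chromatic_number R witness <= n%:R / p%:R.
Proof.
have ps0 : (0 < p * s)%N by rewrite muln_gt0 s_gt0; lia.
apply: (le_trans (fractional_chromatic_number_le R ps0 ground_card ground_edge)).
rewrite card_prod !card_ord !natrM invfM mulrACA divff ?mulr1//.
by rewrite pnatr_eq0 -lt0n.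
Qed.

Lemma witness_sigma_lt : sigma_circle R witness < p%:R / n%:R.
Proof.
pose S0 : odd_vertex := Sub (arc_positions ord0) (introT eqP (card_arc_positions ord0)).
apply: (@odd_kneser_sigma_lt R witness p (fun S => inl (insubd S0 S))) => // S S' cS cS' dS.
rewrite /= /witness_rel /= !val_insubd cS cS' eqxx dS andbT.
apply/eqP => -[] /(congr1 val); rewrite !val_insubd cS cS' eqxx => SS'.
move: dS; rewrite SS' -setI_eq0 finset.setIid -cards_eq0 cS'; lia.
Qed.

(** An even [s] makes the number N of points even. Words of small weight have density at least (1 -
    1/D)/2, and the choice h = ND bounds the loss from excluded digits by Bernoulli: (1 - 1/h)^N >=
    1 - 1/D. *)
Lemma witness_sigma_ge (r D : nat) : s = r.*2 -> (0 < D)%N -> ((s.+1 * D) ^ 2 <= p)%N ->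
  (1 - 2 / D%:R) / 2 <= sigma_circle R witness.
Proof.
move=> sr D_gt0 pD; pose N := #|{: ground}|; pose h := (N * D)%N.
have N_gt0 : (0 < N)%N by rewrite /N ground_size; lia.
have h_gt0 : (0 < h)%N by rewrite muln_gt0 N_gt0.
have [A [mA bA]] := kneser_base R h_gt0 ground_card ground_edge.
rewrite -/N -fine_haar// lee_fin; set sig := (\sum_(j < _) _)%N => hA.
apply: le_trans (sigma_circle_ge mA bA); apply: le_trans hA.
have NE : N = (n * r).*2 by rewrite /N ground_size sr; lia.
have half : (D * 2 ^ N <= (D * sig).*2 + 2 ^ N)%N.
  rewrite /sig -/N NE; apply: (@sum_bin_lower_half (p * s) s); first by rewrite -NE; exact: ground_size.
  by apply: (leq_trans pD); rewrite -NE /N ground_size; nia.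
have D0 : 0 < D%:R :> R by rewrite ltr0n.
have two0 : 0 < 2 ^+ N :> R by rewrite exprn_gt0.
have {}half : (1 - D%:R^-1) / 2 <= sig%:R / 2 ^+ N :> R.
  rewrite ler_pdivlMr// -(ler_pM2l D0).
  have : (D%:R * 2 ^+ N : R) <= 2 * (D%:R * sig%:R) + 2 ^+ N.
    by rewrite -natrX -!natrM -natrD ler_nat mul2n.
  have -> : D%:R * ((1 - D%:R^-1) / 2 * 2 ^+ N) = (D%:R * 2 ^+ N - 2 ^+ N) / 2 :> R.
    by field; rewrite gt_eqF.
  lra.
have h0 : 0 < h%:R :> R by rewrite ltr0n.
have bern : 1 - D%:R^-1 <= (h.-1%:R / h%:R) ^+ N :> R.
  have -> : h.-1%:R / h%:R = 1 - h%:R^-1 :> R.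
    by rewrite -subn1 natrB// mulrBl divff ?gt_eqF// mul1r.
  have -> : D%:R^-1 = N%:R * h%:R^-1 :> R.
    by rewrite /h natrM invfM mulrA divff ?mul1r// pnatr_eq0 -lt0n.
  by apply: bernoulli_ineq; rewrite invr_ge0 ler0n invf_le1// ler1n.
have -> : (h.-1 ^ N * sig)%:R / (h.*2 ^ N)%:R = (h.-1%:R / h%:R) ^+ N * (sig%:R / 2 ^+ N) :> R.
  rewrite natrM !natrX -muln2 natrM exprMn expr_div_n; field.
  by rewrite !expf_neq0 ?gt_eqF.
have D1 : D%:R^-1 <= 1 :> R by rewrite invf_le1// ler1n.
apply: (@le_trans _ _ ((1 - D%:R^-1) * ((1 - D%:R^-1) / 2))); last first.
  by apply: ler_pM => //; rewrite ?divr_ge0// subr_ge0.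
have : 0 <= D%:R^-1 * D%:R^-1 :> R by rewrite mulr_ge0// invr_ge0.
nra.
Qed.

Hypothesis q_gt2 : (2 < q)%N.
Hypothesis s_large : (q ^ q < s.+2)%N.

(** The p-sets avoiding both [ord0] and [ord_max] lie in 2p - 1 points and so pairwise intersect:
    three colors suffice there. The product is colored by its second coordinate. *)
Let circular_color (v : vertex witness) : R :=
  match v with
  | inl A => if ord0 \in val A then 0 else if ord_max \in val A then 1 else 2
  | inr (_, i) => i%:R
  end.

Lemma witness_circular : circular_chromatic_number R witness = q%:R.
Proof.
apply: (@circular_chromatic_numberE R witness q%:R circular_color).
  split=> [[S|[X i]]|[S|[X i]] [S'|[Y j]]] //=.
  - have q2 : 2 < q%:R :> R by rewrite ltr_nat.
    by case: ifP => _; [|case: ifP => _]; lra.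
  - by rewrite ler0n ltr_nat ltn_ord.
  - rewrite /witness_rel /= => /andP[_ dS].
    have d a : a \in val S -> a \in val S' -> False.
      by move=> aS aS'; have /pred0P/(_ a) := dS; rewrite /= aS aS'.
    have q2 : 2 < q%:R :> R by rewrite ltr_nat.
    have q3 : 3 <= q%:R :> R by rewrite ler_nat.
    have : (ord0 \in val S) || (ord_max \in val S) || (ord0 \in val S') || (ord_max \in val S').
      apply: contraT; rewrite !negb_or => /andP[/andP[/andP[a b] c] d'].
      have sub : (val S :|: val S' \subset ~: [set ord0; ord_max])%SET.
        apply/fintype.subsetP => i; rewrite !finset.inE => iS; apply/norP; split; apply/eqP => ie; move: iS; rewrite ie.
          by rewrite (negPf a) (negPf c).
        by rewrite (negPf b) (negPf d').
      have := subset_leq_card sub; rewrite cardsU disjoint_setI0// cards0 subn0.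
      have := cardsC [set (ord0 : 'I_n); ord_max]%SET; rewrite card_ord cards2.
      rewrite (eqP (valP S)) (eqP (valP S')) (_ : ord0 != ord_max); last first.
        by rewrite -val_eqE /= eq_sym -lt0n double_gt0 ltnW.
      by move: #|_| => K /=; clear; lia.
    have := d ord0; have := d ord_max.
    rewrite /val /=.
    move: (ord0 \in sval S) (ord_max \in sval S) (ord0 \in sval S') (ord_max \in sval S').
    have N (x : R) : (1 <= x <= q%:R - 1) || (1 <= - x <= q%:R - 1) -> 1 <= `|x| <= q%:R - 1.
      by case/orP => h; [rewrite ger0_norm|rewrite ler0_norm]; move: h; lra.
    move=> [] [] [] [] //= d1 d0 _; try (by case: (d0 isT isT)); try (by case: (d1 isT isT));
      apply: N; apply/orP; first [by left; lra|by right; lra].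
  - rewrite /witness_rel /= => /andP[_ /andP[_ ij]].
    have q1 (a : 'I_q) : a%:R <= q%:R - 1 :> R.
      by rewrite lerBrDr natr1 ler_nat ltn_ord.
    have a0 (a : 'I_q) : 0 <= a%:R :> R by exact: ler0n.
    have [lt|lt|e] := ltngtP i j; last by rewrite (val_inj e) eqxx in ij.
      have : (i%:R : R) + 1 <= j%:R by rewrite natr1 ler_nat.
      move: (q1 j) (a0 i) => ? ? ?; rewrite ger0_norm; lra.
    have : (j%:R : R) + 1 <= i%:R by rewrite natr1 ler_nat.
    move: (q1 i) (a0 j) => ? ? ?; rewrite ler0_norm; lra.
move=> z f [f_itv f_edge].
pose F (X : {set ground}) i : R := if insub X is Some X' then f (inr (X', i)) else 0.
have FE (X : {set ground}) i (cX : #|X| == (p * s)%N) : F X i = f (inr (Sub X cX, i)).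
  by rewrite /F insubT.
have ps0 : (0 < p * s)%N by rewrite muln_gt0 s_gt0; lia.
apply: (@circular_lower_bound R {: ground}%type (p * s) s q F z ps0 ground_size _ s_large).
- by lia.
- by move=> X /eqP cX i; rewrite (FE X i cX).
- move=> X Y /eqP cX /eqP cY dXY i j ij; rewrite (FE X i cX) (FE Y j cY).
  rewrite distrC; apply: f_edge; rewrite /= /witness_rel /= dXY ij !andbT.
  by apply: contra ij => /eqP[_ ->].
Qed.

End Witness.

(** * Choice of the parameters and the limit *)

(** Here [s] is even and exceeds q^q - 2. The parameter [p] is ((s + 1) D)^2 with D = 2(2(k + 1) +
    1), for which (1 - 2/D)/2 is the inverse of 2 + 1/(k + 1). *)
Definition witness_of (k : nat) : sgraph :=
  let q := (k + 2)%N in let s := (q ^ q).*2 in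
  witness ((s.+1 * (2 * (2 * k.+1 + 1))) ^ 2) s q.

Section Conclusion.
Context (R : realType).

(** The fraction 2 + 1/p separates the fractional chromatic number from the gyrochromatic number and
    also gives the lower bound 2 for the final squeeze. *)
Lemma witness_ofP (k : nat) : (2 <= k)%N ->
  [/\ fractional_chromatic_number R (witness_of k) < gyrochromatic_number R (witness_of k),
      circular_chromatic_number R (witness_of k) = (k + 2)%:R &
      2 <= gyrochromatic_number R (witness_of k) <= 2 + harmonic k].
Proof.
move=> k2; rewrite /witness_of; set q := (k + 2)%N; set s := (q ^ q).*2.
set D := (2 * (2 * k.+1 + 1))%N; set p := ((s.+1 * D) ^ 2)%N.
have q0 : (0 < q ^ q)%N by rewrite expn_gt0; lia.
have s0 : (0 < s)%N by rewrite /s; lia.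
have p1 : (1 < p)%N by rewrite /p; nia.
have sq : (q ^ q < s.+2)%N by rewrite /s; lia.
have q2 : (2 < q)%N by rewrite /q; lia.
have D0 : (0 < D)%N by rewrite /D; lia.
have chi_f := witness_fractional q R p1 s0.
have sigma_lt := witness_sigma_lt q R p1 s0.
have sigma_ge := witness_sigma_ge q R p1 s0 (erefl : s = (q ^ q).*2) D0 (leqnn p).
have chi_c := witness_circular R p1 s0 q2 sq.
have K0 : 0 < k.+1%:R :> R by rewrite ltr0n.
have {}sigma_ge : k.+1%:R / (2 * k.+1%:R + 1) <= sigma_circle R (witness p s q).
  apply: le_trans sigma_ge; rewrite /D !natrM natrD natrM le_eqVlt; apply/orP; left.
  by apply/eqP; field; rewrite gt_eqF//; lra.
have sigma0 : 0 < sigma_circle R (witness p s q).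
  by apply: lt_le_trans sigma_ge; rewrite divr_gt0//; lra.
have pR : 0 < p%:R :> R by rewrite ltr0n; lia.
have gyro_gt : p.*2.+1%:R / p%:R < gyrochromatic_number R (witness p s q).
  rewrite /gyrochromatic_number mul1r -[ltLHS]invf_div ltf_pV2 ?posrE//.
  by rewrite divr_gt0// ltr0n.
split => //; first exact: le_lt_trans chi_f gyro_gt.
apply/andP; split.
  by apply: le_trans (ltW gyro_gt); rewrite ler_pdivlMr// -natrM ler_nat; lia.
rewrite /gyrochromatic_number ler_pdivrMr// /harmonic /=.
apply: (@le_trans _ _ ((2 + k.+1%:R^-1) * (k.+1%:R / (2 * k.+1%:R + 1)))).
  rewrite le_eqVlt; apply/orP; left; apply/eqP; field.
  by rewrite !gt_eqF//; lra.
by rewrite ler_wpM2l// addr_ge0// invr_ge0.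
Qed.

End Conclusion.

Set Strict Implicit.
Unset Implicit Arguments.

Theorem theorem13 (R : realType) : exists G : nat -> sgraph,
  (forall k : nat, (2 <= k)%N ->
    [/\ fractional_chromatic_number R (G k) < gyrochromatic_number R (G k),
        gyrochromatic_number R (G k) <= circular_chromatic_number R (G k) &
        circular_chromatic_number R (G k) = (k + 2)%:R]) /\
  gyrochromatic_number R (G k) @[k --> \oo] --> (2 : R).
Proof.
exists witness_of; split=> [k k2|].
  have [chi_f chi_c /andP[_ gyro_le]] := witness_ofP R k2.
  split => //; rewrite chi_c (le_trans gyro_le)// natrD addrC lerD2r.
  apply: (@le_trans _ _ 1); last by rewrite ler1n; lia.
  by rewrite invf_le1// ler1n.
have lim : 2 + harmonic k @[k --> \oo] --> (2 : R).
  have := cvgD (cvg_cst (2 : R)) (@cvg_harmonic R); rewrite addr0; exact.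
apply: (squeeze_cvgr _ (cvg_cst _) lim).
near=> k; have k2 : (2 <= k)%N by near: k; exact: nbhs_infty_ge.
by have [_ _] := witness_ofP R k2.
Unshelve. all: by end_near.
Qed.
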